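(* Let $(\mathcal{X},\mathcal{X}^\perp)$ be a hereditary and complete cotorsion pair in an abelian category $\mathfrak{C}$ with enough projective objects, and let $\omega=\mathcal{X}\cap\mathcal{X}^\perp$. Suppose there exists $m\in\mathbb{Z}_{\geq 0}$ such that $(\omega^\wedge_m,[\omega^\wedge_m]^{\perp_1})$ is a complete cotorsion pair in $\mathfrak{C}$. Then the following assertions are equivalent: (a) $\mathcal{X}^\perp$ is closed under epikernels (and so, thick). (b) $\omega^\wedge_m$ is closed under epikernels (and so, the pair $(\omega^\wedge_m,[\omega^\wedge_m]^{\perp_1})$ is hereditary). (c) $\omega$ is the class $\mathcal{P}$ of projective objects of $\mathfrak{C}$. If any of these conditions holds, then $(\mathcal{X}^\wedge_m,\ \mathcal{X}^\perp,\ [\mathcal{P}^\wedge_m]^\perp)$ is a Hovey triple in $\mathfrak{C}$, and the homotopy category of its associated hereditary abelian model structure is equivalent to the quotient category $(\mathcal{X}^\wedge_m\cap[\mathcal{P}^\wedge_m]^\perp)/\sim$, where for two morphisms $f,g\colon X\to Y$ with $X,Y\in\mathcal{X}^\wedge_m\cap[\mathcal{P}^\wedge_m]^\perp$ one has $f\sim g$ if, and only if, $f-g$ factors through a trivially bifibrant object, that is, an object in $\mathcal{X}^\wedge_m\cap\mathcal{X}^\perp\cap[\mathcal{P}^\wedge_m]^\perp=\mathcal{P}^\wedge_m\cap[\mathcal{P}^\wedge_m]^\perp$.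
   Context: $A\rightarrowtail B\twoheadrightarrow C$ denotes a short exact sequence. For a class $\mathcal{X}$ in an abelian category $\mathfrak C$: $\mathcal{X}^{\perp_i}=\{N: \mathrm{Ext}^i_{\mathfrak C}(X,N)=0\ \forall X\in\mathcal X\}$ for $i>0$, $\mathcal{X}^\perp=\bigcap_{i>0}\mathcal{X}^{\perp_i}$; ${}^{\perp_1}\mathcal X$ is dual. $\mathcal{X}^\wedge_m$ is the class of objects $M$ having an exact sequence $0\to X_m\to\cdots\to X_0\to M\to 0$ with all $X_i\in\mathcal{X}$ (same notation for $\omega$ and $\mathcal P$). Closed under epikernels means closed under kernels of epimorphisms between objects of the class. A class is thick if it is closed under extensions, epikernels, cokernels of monomorphisms between its objects, and direct summands. A cotorsion pair $(\mathcal A,\mathcal D)$ in $\mathfrak C$: $\mathcal A^{\perp_1}=\mathcal D$ and $\mathcal A={}^{\perp_1}\mathcal D$. It is complete if every $C\in\mathfrak C$ has short exact sequences $D\rightarrowtail A\twoheadrightarrow C$ and $C\rightarrowtail D'\twoheadrightarrow A'$ with $A,A'\in\mathcal A$, $D,D'\in\mathcal D$; hereditary if $\mathrm{Ext}^i_{\mathfrak C}(A,D)=0$ for all $A\in\mathcal A$, $D\in\mathcal D$, $i>0$. A Hovey triple $(\mathcal Q,\mathcal W,\mathcal R)$ in $\mathfrak C$: $\mathcal W$ is thick and $(\mathcal Q\cap\mathcal W,\mathcal R)$, $(\mathcal Q,\mathcal W\cap\mathcal R)$ are complete cotorsion pairs; here both are also hereditary (hereditary Hovey triple). Its associated (hereditary)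 abelian model structure has as (trivial) cofibrations the monomorphisms with cokernel in $\mathcal Q$ (resp. $\mathcal Q\cap\mathcal W$), as (trivial) fibrations the epimorphisms with kernel in $\mathcal R$ (resp. $\mathcal W\cap\mathcal R$), and as weak equivalences the composites of a trivial cofibration followed by a trivial fibration. $\mathcal Q$, $\mathcal W$, $\mathcal R$ are the classes of cofibrant, trivial and fibrant objects; bifibrant means in $\mathcal Q\cap\mathcal R$, trivially bifibrant means in $\mathcal Q\cap\mathcal W\cap\mathcal R$. The homotopy category is the localization at the weak equivalences. *)

(* Defs.v *)
From HB Require Import structures.
From mathcomp Require Import all_boot all_order all_algebra.
From mathcomp Require Import boolp classical_sets.
Set Implicit Arguments.
Unset Strict Implicit.
Unset Printing Implicit Defensive.
Import GRing.Theory.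
Local Open Scope classical_set_scope.
Local Open Scope ring_scope.

Record category := Category {
  ob :> Type;
  mor : ob -> ob -> Type;
  idc : forall X, mor X X;
  compc : forall X Y Z, mor Y Z -> mor X Y -> mor X Z;
  compc1l : forall X Y (f : mor X Y), compc (idc Y) f = f;
  compc1r : forall X Y (f : mor X Y), compc f (idc X) = f;
  compcA : forall X Y Z T (h : mor Z T) (g : mor Y Z) (f : mor X Y),
    compc h (compc g f) = compc (compc h g) f }.

Arguments mor {c} X Y.
Arguments idc {c} X.
Arguments compc {c X Y Z} g f.
Notation "g ∘ f" := (compc g f) (at level 40, left associativity).

Section CategoryNotions.
Variable C : category.

Definition is_iso (X Y : C) (f : mor X Y) : Prop :=
  exists g : mor Y X, g ∘ f = idc X /\ f ∘ g = idc Y.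

Definition mono (X Y : C) (f : mor X Y) : Prop :=
  forall (T : C) (g h : mor T X), f ∘ g = f ∘ h -> g = h.

Definition epi (X Y : C) (f : mor X Y) : Prop :=
  forall (T : C) (g h : mor Y T), g ∘ f = h ∘ f -> g = h.

Definition projective : set C := [set P |
  forall (A B : C) (p : mor A B) (f : mor P B), epi p ->
    exists g : mor P A, p ∘ g = f].

Definition enough_projectives : Prop :=
  forall M : C, exists P (p : mor P M), projective P /\ epi p.

Definition morclass := forall X Y : C, set (mor X Y).

Record is_congruence (R : forall X Y : C, mor X Y -> mor X Y -> Prop) : Prop := {
  cong_refl : forall X Y (f : mor X Y), R X Y f f;
  cong_sym : forall X Y (f g : mor X Y), R X Y f g -> R X Y g f;
  cong_trans : forall X Y (f g h : mor X Y), R X Y f g -> R X Y g h -> R X Y f h;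
  cong_comp : forall X Y Z (f f' : mor X Y) (g g' : mor Y Z),
    R X Y f f' -> R Y Z g g' -> R X Z (g ∘ f) (g' ∘ f') }.

End CategoryNotions.

Arguments projective C : clear implicits.
Arguments enough_projectives C : clear implicits.
Arguments morclass C : clear implicits.

Definition full_subcategory (C : category) (A : set C) : category :=
  @Category {X : C | A X} (fun X Y => mor (sval X) (sval Y))
    (fun X => idc (sval X)) (fun X Y Z g f => g ∘ f)
    (fun X Y f => compc1l f) (fun X Y f => compc1r f)
    (fun X Y Z T h g f => compcA h g f).

Record functor (C D : category) := Functor {
  fob :> C -> D;
  fmap : forall X Y : C, mor X Y -> mor (fob X) (fob Y);
  fmap1 : forall X : C, fmap (idc X) = idc (fob X);
  fmapc : forall (X Y Z : C) (g : mor Y Z) (f : mor X Y),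
    fmap (g ∘ f) = fmap g ∘ fmap f }.

Arguments fmap {C D} _ {X Y} _.

Definition functor_id (C : category) : functor C C :=
  @Functor C C id (fun X Y f => f) (fun=> erefl) (fun _ _ _ _ _ => erefl).

Lemma functor_comp_id (C D E : category) (G : functor D E) (F : functor C D)
  (X : C) : fmap G (fmap F (idc X)) = idc (G (F X)).
Proof. by rewrite !fmap1. Qed.

Lemma functor_comp_comp (C D E : category) (G : functor D E) (F : functor C D)
  (X Y Z : C) (g : mor Y Z) (f : mor X Y) :
  fmap G (fmap F (g ∘ f)) = fmap G (fmap F g) ∘ fmap G (fmap F f).
Proof. by rewrite !fmapc. Qed.

Definition functor_comp (C D E : category) (G : functor D E) (F : functor C D) :
    functor C E :=
  @Functor C E (G \o F) (fun X Y f => fmap G (fmap F f))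
    (functor_comp_id G F) (@functor_comp_comp _ _ _ G F).

Definition natural (C D : category) (F G : functor C D)
    (a : forall X, mor (F X) (G X)) : Prop :=
  forall (X Y : C) (f : mor X Y), a Y ∘ fmap F f = fmap G f ∘ a X.

Definition naturally_isomorphic (C D : category) (F G : functor C D) : Prop :=
  exists a : forall X, mor (F X) (G X), natural a /\ forall X, is_iso (a X).

Definition equivalent_categories (C D : category) : Prop :=
  exists (F : functor C D) (G : functor D C),
    naturally_isomorphic (functor_comp G F) (functor_id C) /\
    naturally_isomorphic (functor_comp F G) (functor_id D).

(* [L : C -> H] is a localization of [C] at [W]: for every category [D],
   precomposition with [L] is an equivalence from the functors [H -> D] to the
   functors [C -> D] that invert [W]. *)
Record is_localization (C H : category) (W : morclass C) (L : functor C H) :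
    Prop := {
  loc_inverts : forall (X Y : C) (f : mor X Y), W X Y f -> is_iso (fmap L f);
  loc_factor : forall (D : category) (F : functor C D),
    (forall (X Y : C) (f : mor X Y), W X Y f -> is_iso (fmap F f)) ->
    exists G : functor H D, naturally_isomorphic (functor_comp G L) F;
  loc_ff : forall (D : category) (G G' : functor H D)
      (a : forall X : C, mor (G (L X)) (G' (L X))),
    @natural _ _ (functor_comp G L) (functor_comp G' L) a ->
    exists! b : forall Y : H, mor (G Y) (G' Y),
      natural b /\ forall X : C, b (L X) = a X }.

Section Quotient.
Variables (C : category) (R : forall X Y : C, mor X Y -> mor X Y -> Prop).
Hypothesis congR : is_congruence R.
Local Open Scope quotient_scope.

Definition quot_rel (X Y : C) : rel {classic mor X Y} := fun f g => `[< R f g >].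

Lemma quot_rel_refl (X Y : C) : reflexive (@quot_rel X Y).
Proof. by move=> f; apply/asboolP/(cong_refl congR). Qed.

Lemma quot_rel_sym (X Y : C) : symmetric (@quot_rel X Y).
Proof. by move=> f g; apply/asboolP/asboolP => /(cong_sym congR). Qed.

Lemma quot_rel_trans (X Y : C) : transitive (@quot_rel X Y).
Proof.
by move=> g f h /asboolP fg /asboolP gh; apply/asboolP/(cong_trans congR fg gh).
Qed.

Canonical quot_equiv (X Y : C) := EquivRel (@quot_rel X Y)
  (@quot_rel_refl X Y) (@quot_rel_sym X Y) (@quot_rel_trans X Y).

Definition quot_hom (X Y : C) : Type := {eq_quot (quot_equiv X Y)}.

Definition quot_pi (X Y : C) (f : mor X Y) : quot_hom X Y :=
  \pi_({eq_quot (quot_equiv X Y)}) (f : {classic mor X Y}).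

Definition quot_repr (X Y : C) (f : quot_hom X Y) : mor X Y :=
  repr (f : {eq_quot (quot_equiv X Y)}).

Lemma quot_piP (X Y : C) (f g : mor X Y) : quot_pi f = quot_pi g <-> R f g.
Proof.
split=> [/eqquotP /asboolP //|Rfg].
by apply/eqquotP/asboolP.
Qed.

Lemma quot_reprK (X Y : C) (f : quot_hom X Y) : quot_pi (quot_repr f) = f.
Proof. exact: reprK. Qed.

Lemma quot_repr_pi (X Y : C) (f : mor X Y) : R (quot_repr (quot_pi f)) f.
Proof. by apply/quot_piP; rewrite quot_reprK. Qed.

Definition quot_comp (X Y Z : C) (g : quot_hom Y Z) (f : quot_hom X Y) :
  quot_hom X Z := quot_pi (quot_repr g ∘ quot_repr f).

Lemma quot_comp1c (X Y : C) (f : quot_hom X Y) : quot_comp (quot_pi (idc Y)) f = f.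
Proof.
rewrite -[RHS]quot_reprK; apply/quot_piP; rewrite -[X in R _ X]compc1l.
exact: (cong_comp congR) (cong_refl congR _) (quot_repr_pi _).
Qed.

Lemma quot_compc1 (X Y : C) (f : quot_hom X Y) : quot_comp f (quot_pi (idc X)) = f.
Proof.
rewrite -[RHS]quot_reprK; apply/quot_piP; rewrite -[X in R _ X]compc1r.
exact: (cong_comp congR) (quot_repr_pi _) (cong_refl congR _).
Qed.

Lemma quot_compA (X Y Z T : C) (h : quot_hom Z T) (g : quot_hom Y Z)
  (f : quot_hom X Y) :
  quot_comp h (quot_comp g f) = quot_comp (quot_comp h g) f.
Proof.
apply/quot_piP; apply: (cong_trans congR).
  exact: (cong_comp congR) (quot_repr_pi _) (cong_refl congR _).
rewrite compcA; apply: (cong_sym congR).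
exact: (cong_comp congR) (cong_refl congR _) (quot_repr_pi _).
Qed.

Definition quotient_category : category :=
  @Category C quot_hom (fun X => quot_pi (idc X)) quot_comp
    quot_comp1c quot_compc1 quot_compA.

End Quotient.

(* The compatibility axioms cannot use [+%R] on [mor X Y]: the canonical group
   structure on [mor X Y] is only declared after the record. *)
Record preadditive := Preadditive {
  preadd_cat :> category;
  preadd_zmod : forall X Y : preadd_cat, GRing.Zmodule (mor X Y);
  preadd_compDl : forall (X Y Z : preadd_cat) (g g' : mor Y Z) (f : mor X Y),
    @GRing.add (GRing.Zmodule.Pack (preadd_zmod Y Z)) g g' ∘ f
    = @GRing.add (GRing.Zmodule.Pack (preadd_zmod X Z)) (g ∘ f) (g' ∘ f);
  preadd_compDr : forall (X Y Z : preadd_cat) (g : mor Y Z) (f f' : mor X Y),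
    g ∘ @GRing.add (GRing.Zmodule.Pack (preadd_zmod X Y)) f f'
    = @GRing.add (GRing.Zmodule.Pack (preadd_zmod X Z)) (g ∘ f) (g ∘ f') }.

HB.instance Definition _ (C : preadditive) (X Y : C) : GRing.Zmodule (mor X Y) :=
  preadd_zmod X Y.

Lemma compcDl (C : preadditive) (X Y Z : C) (g g' : mor Y Z) (f : mor X Y) :
  (g + g') ∘ f = g ∘ f + g' ∘ f.
Proof. exact: preadd_compDl. Qed.

Lemma compcDr (C : preadditive) (X Y Z : C) (g : mor Y Z) (f f' : mor X Y) :
  g ∘ (f + f') = g ∘ f + g ∘ f'.
Proof. exact: preadd_compDr. Qed.

Section PreadditiveNotions.
Variable C : preadditive.

Definition zero_object : set C := [set Z |
  forall T : C, (forall f : mor Z T, f = 0) /\ (forall f : mor T Z, f = 0)].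

Definition is_biproduct (A B S : C) (i1 : mor A S) (i2 : mor B S)
    (p1 : mor S A) (p2 : mor S B) : Prop :=
  [/\ p1 ∘ i1 = idc A, p2 ∘ i2 = idc B, p2 ∘ i1 = 0, p1 ∘ i2 = 0
    & i1 ∘ p1 + i2 ∘ p2 = idc S].

Definition is_kernel (K A B : C) (k : mor K A) (f : mor A B) : Prop :=
  f ∘ k = 0 /\
  forall (T : C) (g : mor T A), f ∘ g = 0 -> exists! h : mor T K, k ∘ h = g.

Definition is_cokernel (A B Q : C) (q : mor B Q) (f : mor A B) : Prop :=
  q ∘ f = 0 /\
  forall (T : C) (g : mor B T), g ∘ f = 0 -> exists! h : mor Q T, h ∘ q = g.

Record is_abelian : Prop := {
  ab_zero : exists Z : C, zero_object Z;
  ab_biproduct : forall A B : C, exists S i1 i2 p1 p2,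
    @is_biproduct A B S i1 i2 p1 p2;
  ab_kernel : forall (A B : C) (f : mor A B), exists K (k : mor K A),
    is_kernel k f;
  ab_cokernel : forall (A B : C) (f : mor A B), exists Q (q : mor B Q),
    is_cokernel q f;
  ab_mono : forall (A B : C) (f : mor A B), mono f ->
    exists Q (q : mor B Q), is_kernel f q;
  ab_epi : forall (A B : C) (f : mor A B), epi f ->
    exists K (k : mor K A), is_cokernel f k }.

End PreadditiveNotions.

Arguments zero_object C : clear implicits.
Arguments is_abelian C : clear implicits.

Record abelian := Abelian {
  ab_cat :> preadditive;
  abP : is_abelian ab_cat }.

Section AbelianNotions.
Variable C : abelian.
Implicit Types A B D M N X Y Z : C.
Implicit Types AA DD QQ RR WW XX : set C.

Definition short_exact A B D (i : mor A B) (p : mor B D) : Prop :=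
  is_kernel i p /\ is_cokernel p i.

(* Exactness at [B]: [f] factors as an epimorphism followed by a kernel of [g],
   that is, the image of [f] is the kernel of [g]. *)
Definition exact A B D (f : mor A B) (g : mor B D) : Prop :=
  exists I (e : mor A I) (i : mor I B), [/\ epi e, f = i ∘ e & is_kernel i g].

(* An exact sequence [... -> X 2 -> X 1 -> X 0 -> M -> 0]. *)
Definition is_resolution M (X : nat -> C)
    (d : forall n, mor (X n.+1) (X n)) (e : mor (X 0%N) M) : Prop :=
  [/\ epi e, exact (d 0%N) e & forall n, exact (d n.+1) (d n)].

(* The coboundaries and cocycles of the complex
   [0 -> Hom(P 0, N) -> Hom(P 1, N) -> ...]. *)
Definition cocycle (P : nat -> C) (d : forall n, mor (P n.+1) (P n)) N
    (n : nat) (c : mor (P n) N) : Prop := c ∘ d n = 0.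

Definition coboundary (P : nat -> C) (d : forall n, mor (P n.+1) (P n)) N
    (n : nat) : mor (P n) N -> Prop :=
  match n return mor (P n) N -> Prop with
  | 0 => fun c => c = 0
  | n'.+1 => fun c => exists b : mor (P n') N, c = b ∘ d n'
  end.

(* [Ext^n(M, N) = 0]: the [n]-th cohomology of [Hom(P, N)] vanishes for the
   projective resolutions [P] of [M]. It is the same group for all of them;
   this is the Ext functor when the category has enough projectives. *)
Definition Ext_vanishes (n : nat) M N : Prop :=
  forall (P : nat -> C) (d : forall n, mor (P n.+1) (P n)) (e : mor (P 0%N) M),
    (forall k, projective C (P k)) -> is_resolution d e ->
    forall c : mor (P n) N, cocycle d c -> coboundary d c.

Definition perp_ (i : nat) XX : set C :=
  [set N | forall X, XX X -> Ext_vanishes i X N].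

Definition perp XX : set C :=
  [set N | forall i : nat, (0 < i)%N -> perp_ i XX N].

Definition lperp_ (i : nat) XX : set C :=
  [set M | forall X, XX X -> Ext_vanishes i M X].

(* The objects [M] with an exact sequence [0 -> X m -> ... -> X 0 -> M -> 0],
   [X i] in [XX]: the sequence is continued by zero objects. *)
Definition fin_res (XX : set C) (m : nat) : set C := [set M |
  exists (X : nat -> C) (d : forall n, mor (X n.+1) (X n)) (e : mor (X 0%N) M),
    [/\ is_resolution d e,
        forall i, (i <= m)%N -> XX (X i)
      & forall i, (m < i)%N -> zero_object C (X i)]].

Definition closed_extensions XX : Prop :=
  forall A B D (i : mor A B) (p : mor B D),
    short_exact i p -> XX A -> XX D -> XX B.

Definition closed_epikernels XX : Prop :=
  forall A B D (i : mor A B) (p : mor B D),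
    short_exact i p -> XX B -> XX D -> XX A.

Definition closed_monocokernels XX : Prop :=
  forall A B D (i : mor A B) (p : mor B D),
    short_exact i p -> XX A -> XX B -> XX D.

Definition closed_summands XX : Prop :=
  forall A B S (i1 : mor A S) (i2 : mor B S) (p1 : mor S A) (p2 : mor S B),
    is_biproduct i1 i2 p1 p2 -> XX S -> XX A.

Definition thick XX : Prop :=
  [/\ closed_extensions XX, closed_epikernels XX, closed_monocokernels XX
    & closed_summands XX].

Definition cotorsion_pair AA DD : Prop := perp_ 1 AA = DD /\ AA = lperp_ 1 DD.

Definition complete_pair AA DD : Prop := forall M,
  (exists A D (i : mor D A) (p : mor A M), [/\ short_exact i p, AA A & DD D]) /\
  (exists A D (i : mor M D) (p : mor D A), [/\ short_exact i p, AA A & DD D]).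

Definition hereditary_pair AA DD : Prop :=
  forall A D, AA A -> DD D -> forall i : nat, (0 < i)%N -> Ext_vanishes i A D.

Definition complete_cotorsion_pair AA DD : Prop :=
  cotorsion_pair AA DD /\ complete_pair AA DD.

Definition Hovey_triple QQ WW RR : Prop :=
  [/\ thick WW, complete_cotorsion_pair (QQ `&` WW) RR
    & complete_cotorsion_pair QQ (WW `&` RR)].

Definition hereditary_Hovey_triple QQ WW RR : Prop :=
  [/\ Hovey_triple QQ WW RR, hereditary_pair (QQ `&` WW) RR
    & hereditary_pair QQ (WW `&` RR)].

Definition mono_with_cokernel_in QQ : morclass C := fun X Y =>
  [set f | mono f /\ exists Z (q : mor Y Z), is_cokernel q f /\ QQ Z].

Definition epi_with_kernel_in RR : morclass C := fun X Y =>
  [set f | epi f /\ exists Z (k : mor Z X), is_kernel k f /\ RR Z].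

(* The composites of a trivial cofibration followed by a trivial fibration in the
   model structure associated with the Hovey triple [(QQ, WW, RR)]. *)
Definition weak_equivalence QQ WW RR : morclass C := fun X Y =>
  [set f | exists Z (i : mor X Z) (p : mor Z Y),
    [/\ mono_with_cokernel_in (QQ `&` WW) i, epi_with_kernel_in (WW `&` RR) p
      & f = p ∘ i]].

Definition is_homotopy_category QQ WW RR (Ho : category) : Prop :=
  exists L : functor C Ho, is_localization (weak_equivalence QQ WW RR) L.

Definition factors_through XX X Y (f : mor X Y) : Prop :=
  exists Z (a : mor X Z) (b : mor Z Y), XX Z /\ f = b ∘ a.

Definition stably_equal (BB TT : set C) (X Y : full_subcategory BB)
    (f g : mor X Y) : Prop :=
  factors_through TT ((f : mor (sval X) (sval Y)) - g).

End AbelianNotions.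

Arguments stably_equal {C} BB TT X Y f g.

(* Main.v *)
(* Write Y for the right orthogonal of X, w for the intersection of X and Y, and F
   for the class of cokernels of length m built from w. Since F is the left half of
   a cotorsion pair, it contains the projectives, and it lies in Y because Y is
   closed under cokernels of monomorphisms; so the projectives lie in w. If Y or F
   is closed under epikernels, then the syzygy of an object of w lies in Y, its
   presentation splits, and w consists of projectives. Conversely, if w is the class
   of projectives, a map from an object of X to one of Y extends to a projective
   object, hence lifts along epimorphisms, which gives the closure of Y.

   An object has X-dimension at most m exactly when Ext^(m+1) to Y vanishes, and
   special approximations show that those in Y are the objects of F. Composing a
   special preenvelope for (X, Y) with one for F gives the preenvelopes of the second
   cotorsion pair; Salce's pushout gives the precovers.

   For any hereditary Hovey triple, sending an object to a bifibrant replacement is a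
   functor to the stable category of bifibrant objects: a map factors through a
   trivial object as soon as its restriction along a trivial cofibration, or its
   composite with a trivial fibration, does. This functor is a localization, and
   localizations are unique up to equivalence. *)
Require Import Defs.
From mathcomp Require Import all_boot all_order all_algebra.
From mathcomp Require Import boolp classical_sets.
Set Implicit Arguments.
Unset Strict Implicit.
Unset Printing Implicit Defensive.
Import GRing.Theory.
Local Open Scope classical_set_scope.
Local Open Scope ring_scope.

(** * Monomorphisms, epimorphisms and isomorphisms *)

Section MonoEpi.
Variable C : category.
Implicit Types A B D T : C.

Lemma comp_mono A B D (g : mor B D) (f : mor A B) : mono g -> mono f -> mono (g ∘ f).
Proof. by move=> gm fm T x y; rewrite -!compcA => /gm /fm. Qed.

Lemma comp_epi A B D (g : mor B D) (f : mor A B) : epi g -> epi f -> epi (g ∘ f).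
Proof. by move=> ge fe T x y; rewrite !compcA => /fe /ge. Qed.

Lemma section_mono A B (f : mor A B) (g : mor B A) : g ∘ f = idc A -> mono f.
Proof. by move=> gf T x y fxy; rewrite -[x]compc1l -[y]compc1l -gf -!compcA fxy. Qed.

Lemma retraction_epi A B (f : mor A B) (g : mor B A) : g ∘ f = idc A -> epi g.
Proof. by move=> gf T x y fxy; rewrite -[x]compc1r -[y]compc1r -gf !compcA fxy. Qed.

Lemma iso_mono A B (f : mor A B) : is_iso f -> mono f.
Proof. by case=> g [gf _]; apply: section_mono gf. Qed.

Lemma iso_epi A B (f : mor A B) : is_iso f -> epi f.
Proof. by case=> g [_ fg]; apply: retraction_epi fg. Qed.

End MonoEpi.

(** * Bilinearity of composition; kernels are monic, cokernels epic *)

Section PreadditiveBasics.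
Variable C : preadditive.
Implicit Types A B D T : C.

Lemma comp0c A B D (f : mor A B) : (0 : mor B D) ∘ f = 0.
Proof. by apply: (addrI (0 ∘ f)); rewrite -compcDl !addr0. Qed.

Lemma compc0 A B D (g : mor B D) : g ∘ (0 : mor A B) = 0.
Proof. by apply: (addrI (g ∘ 0)); rewrite -compcDr !addr0. Qed.

Lemma compNc A B D (g : mor B D) (f : mor A B) : (- g) ∘ f = - (g ∘ f).
Proof. by apply: (addrI (g ∘ f)); rewrite -compcDl !subrr comp0c. Qed.

Lemma compcN A B D (g : mor B D) (f : mor A B) : g ∘ (- f) = - (g ∘ f).
Proof. by apply: (addrI (g ∘ f)); rewrite -compcDr !subrr compc0. Qed.

Lemma compBc A B D (g g' : mor B D) (f : mor A B) : (g - g') ∘ f = g ∘ f - g' ∘ f.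
Proof. by rewrite compcDl compNc. Qed.

Lemma compcB A B D (g : mor B D) (f f' : mor A B) : g ∘ (f - f') = g ∘ f - g ∘ f'.
Proof. by rewrite compcDr compcN. Qed.

Lemma mono_eq0 A B T (f : mor A B) (x : mor T A) : mono f -> f ∘ x = 0 -> x = 0.
Proof. by move=> fm fx; apply: fm; rewrite fx compc0. Qed.

Lemma epi_eq0 A B T (f : mor A B) (x : mor B T) : epi f -> x ∘ f = 0 -> x = 0.
Proof. by move=> fe xf; apply: fe; rewrite xf comp0c. Qed.

Lemma kernel_mono K A B (k : mor K A) (f : mor A B) : is_kernel k f -> mono k.
Proof.
move=> [fk0 univ] T g h kgh.
have [|r [_ runiq]] := univ T (k ∘ g); first by rewrite compcA fk0 comp0c.
by rewrite -(runiq g) ?(runiq h).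
Qed.

Lemma cokernel_epi A B Q (q : mor B Q) (f : mor A B) : is_cokernel q f -> epi q.
Proof.
move=> [qf0 univ] T g h gqh.
have [|r [_ runiq]] := univ T (g ∘ q); first by rewrite -compcA qf0 compc0.
by rewrite -(runiq g) ?(runiq h).
Qed.

End PreadditiveBasics.

(** * Short exact sequences and pullbacks in an abelian category *)

Section AbelianBasics.
Variable C : abelian.
Implicit Types A B D E K L M N P S T : C.

Lemma ses_mono A B D (i : mor A B) (p : mor B D) : short_exact i p -> mono i.
Proof. by case=> /kernel_mono. Qed.

Lemma ses_epi A B D (i : mor A B) (p : mor B D) : short_exact i p -> epi p.
Proof. by case=> _ /cokernel_epi. Qed.

Lemma ses_comp0 A B D (i : mor A B) (p : mor B D) : short_exact i p -> p ∘ i = 0.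
Proof. by case=> -[]. Qed.

Lemma kernel_lift K A B T (k : mor K A) (f : mor A B) (g : mor T A) :
  is_kernel k f -> f ∘ g = 0 -> exists h, k ∘ h = g.
Proof. by move=> [_ univ] /univ [h [<- _]]; exists h. Qed.

Lemma cokernel_desc A B Q T (q : mor B Q) (f : mor A B) (g : mor B T) :
  is_cokernel q f -> g ∘ f = 0 -> exists h, h ∘ q = g.
Proof. by move=> [_ univ] /univ [h [<- _]]; exists h. Qed.

Lemma ses_lift A B D T (i : mor A B) (p : mor B D) (g : mor T B) :
  short_exact i p -> p ∘ g = 0 -> exists h, i ∘ h = g.
Proof. by case=> ik _; exact: kernel_lift. Qed.

Lemma ses_desc A B D T (i : mor A B) (p : mor B D) (g : mor B T) :
  short_exact i p -> g ∘ i = 0 -> exists h, h ∘ p = g.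
Proof. by case=> _ pc; exact: cokernel_desc. Qed.

Lemma mono_kernel A B D (i : mor A B) (p : mor B D) :
  mono i -> p ∘ i = 0 ->
  (forall T (g : mor T B), p ∘ g = 0 -> exists h, i ∘ h = g) -> is_kernel i p.
Proof.
move=> im pi0 lift; split=> // T g /lift [h ih]; exists h; split=> // h' ih'.
by apply: im; rewrite ih.
Qed.

Lemma epi_cokernel A B D (i : mor A B) (p : mor B D) :
  epi p -> p ∘ i = 0 ->
  (forall T (g : mor B T), g ∘ i = 0 -> exists h, h ∘ p = g) -> is_cokernel p i.
Proof.
move=> pe pi0 desc; split=> // T g /desc [h hp]; exists h; split=> // h' hp'.
by apply: pe; rewrite hp.
Qed.

Lemma kernel_ses A B D (i : mor A B) (p : mor B D) :
  is_kernel i p -> epi p -> short_exact i p.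
Proof.
move=> ik pe; split=> //; have [K [k kp]] := ab_epi (abP C) pe.
apply: epi_cokernel => // [|T g gi0]; first by case: ik.
have [h hk] := kernel_lift ik (proj1 kp).
by apply: (cokernel_desc kp); rewrite -hk compcA gi0 comp0c.
Qed.

Lemma cokernel_ses A B D (i : mor A B) (p : mor B D) :
  is_cokernel p i -> mono i -> short_exact i p.
Proof.
move=> pk im; split=> //; have [Q [q qi]] := ab_mono (abP C) im.
apply: mono_kernel => // [|T g pg0]; first by case: pk.
have [h hk] := cokernel_desc pk (proj1 qi).
by apply: (kernel_lift qi); rewrite -hk -compcA pg0 compc0.
Qed.

Lemma epi_ses B D (p : mor B D) : epi p -> exists A (i : mor A B), short_exact i p.
Proof.
by move=> pe; have [K [k kp]] := ab_kernel (abP C) p; exists K, k; apply: kernel_ses.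
Qed.

Lemma mono_ses A B (i : mor A B) : mono i -> exists D (p : mor B D), short_exact i p.
Proof.
by move=> im; have [Q [q qi]] := ab_cokernel (abP C) i; exists Q, q; apply: cokernel_ses.
Qed.

(** The kernel of [f] is zero and [f] is the cokernel of its kernel, so the identity of [A] descends
    along [f]. *)
Lemma mono_epi_iso A B (f : mor A B) : mono f -> epi f -> is_iso f.
Proof.
move=> fm /[dup] fe /epi_ses [K [k fk]].
have k0 : k = 0 by apply: (mono_eq0 fm); apply: ses_comp0 fk.
have [|h hf] := ses_desc (g := idc A) fk; first by rewrite k0 compc0.
by exists h; split=> //; apply: fe; rewrite -compcA hf compc1l compc1r.
Qed.

Lemma ses_idr A : exists Z (z : mor Z A), zero_object C Z /\ short_exact z (idc A).
Proof.
have [Z Z0] := ab_zero (abP C); exists Z, 0; split=> //; apply: kernel_ses; last first.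
  by move=> T g h; rewrite !compc1r.
apply: mono_kernel => [T g h _||T g].
- by rewrite (proj2 (Z0 T) g) (proj2 (Z0 T) h).
- by rewrite compc0.
- by rewrite compc1l => ->; exists 0; rewrite compc0.
Qed.

Lemma ses_idl A : exists Z (z : mor A Z), zero_object C Z /\ short_exact (idc A) z.
Proof.
have [Z Z0] := ab_zero (abP C); exists Z, 0; split=> //; apply: cokernel_ses; last first.
  by move=> T g h; rewrite !compc1l.
apply: epi_cokernel => [T g h _||T g].
- by rewrite (proj1 (Z0 T) g) (proj1 (Z0 T) h).
- by rewrite comp0c.
- by rewrite compc1r => ->; exists 0; rewrite comp0c.
Qed.

Lemma biproduct_ses A B S (i1 : mor A S) (i2 : mor B S) (p1 : mor S A) (p2 : mor S B) :
  is_biproduct i1 i2 p1 p2 -> short_exact i1 p2.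
Proof.
case=> p1i1 p2i2 p2i1 _ sumE; apply: kernel_ses; last exact: retraction_epi p2i2.
apply: mono_kernel => // [|T g p2g]; first exact: section_mono p1i1.
by exists (p1 ∘ g); rewrite -[RHS]compc1l -sumE compcDl -!compcA p2g compc0 addr0.
Qed.

Lemma ses_retract A B D (i : mor A B) (p : mor B D) (s : mor D B) :
  short_exact i p -> p ∘ s = idc D -> exists r, r ∘ i = idc A.
Proof.
move=> ip ps; have [|r ir] := ses_lift (g := idc B - s ∘ p) ip.
  by rewrite compcB compc1r compcA ps compc1l subrr.
exists r; apply: (ses_mono ip).
by rewrite compcA ir compBc -compcA (ses_comp0 ip) compc0 subr0 compc1l compc1r.
Qed.

(** [E] is the kernel of [f ∘ p1 - g ∘ p2] on the biproduct. Its universal property is split into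
    existence and joint monicity, the form that chases use. *)
Lemma pullback A B D (f : mor A D) (g : mor B D) : epi f ->
  exists E (u : mor E A) (v : mor E B), [/\ f ∘ u = g ∘ v, epi v,
    forall T (x : mor T A) (y : mor T B), f ∘ x = g ∘ y ->
      exists z, u ∘ z = x /\ v ∘ z = y
  & forall T (z : mor T E), u ∘ z = 0 -> v ∘ z = 0 -> z = 0].
Proof.
move=> fe; have [S [i1 [i2 [p1 [p2 [p1i1 p2i2 p2i1 p1i2 sumE]]]]]] :=
  ab_biproduct (abP C) A B.
pose h := f ∘ p1 - g ∘ p2.
have hi1 : h ∘ i1 = f by rewrite compBc -!compcA p1i1 p2i1 compc0 subr0 compc1r.
have hi2 : h ∘ i2 = - g by rewrite compBc -!compcA p1i2 p2i2 compc0 sub0r compc1r.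
have he : epi h by move=> T x y xy; apply: fe; rewrite -hi1 !compcA xy.
have [E [j jh]] := epi_ses he.
have E0 T (z : mor T E) : p1 ∘ j ∘ z = 0 -> p2 ∘ j ∘ z = 0 -> z = 0.
  move=> z1 z2; apply: (mono_eq0 (ses_mono jh)).
  rewrite -compcA in z1; rewrite -compcA in z2.
  by rewrite -[j ∘ z]compc1l -sumE compcDl -!compcA z1 z2 !compc0 addr0.
have hj : f ∘ (p1 ∘ j) = g ∘ (p2 ∘ j).
  by apply/eqP; rewrite -subr_eq0 !compcA -compBc (ses_comp0 jh).
exists E, (p1 ∘ j), (p2 ∘ j); split=> // [T x y xy|T x y xy].
  apply/eqP; rewrite -subr_eq0; apply/eqP.
  (* [(x - y) ∘ p2] kills [E], so it is some [v ∘ h]. Composing with [i1] gives [v ∘ f = 0], hence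
     [v = 0]. *)
  have [|v vh] := ses_desc (g := (x - y) ∘ p2) jh.
    by rewrite -compcA compBc xy subrr.
  have v0 : v = 0.
    by apply: (epi_eq0 fe); rewrite -hi1 compcA vh -compcA p2i1 compc0.
  by rewrite -[x - y]compc1r -p2i2 compcA -vh v0 !comp0c.
have [|z jz] := ses_lift (g := i1 ∘ x + i2 ∘ y) jh.
  by rewrite compcDr !compcA hi1 hi2 compNc xy subrr.
exists z; rewrite -!compcA jz !compcDr !compcA p1i1 p2i2 p2i1 p1i2.
by rewrite !comp0c !compc1l addr0 add0r.
Qed.

(** * Diagram chasing with maps from projectives as elements *)

Hypothesis enoughP : enough_projectives C.

Lemma mono_test A B (f : mor A B) :
  (forall P (x : mor P A), projective C P -> f ∘ x = 0 -> x = 0) -> mono f.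
Proof.
move=> test T g h fgh; apply/eqP; rewrite -subr_eq0; apply/eqP.
have [P [p [Pp pe]]] := enoughP T; apply: (epi_eq0 pe); apply: test => //.
by rewrite compcA compcB fgh subrr comp0c.
Qed.

Lemma epi_test A B (f : mor A B) :
  (forall P (x : mor P B), projective C P -> exists y, f ∘ y = x) -> epi f.
Proof.
move=> test T g h gfh; have [P [p [Pp pe]]] := enoughP B; apply: pe.
by have [y <-] := test P p Pp; rewrite !compcA gfh.
Qed.

(** The chase shows that the comparison of [i] with an actual kernel of [p] is mono and epi, hence
    invertible. *)
Lemma ses_test A B D (i : mor A B) (p : mor B D) :
  p ∘ i = 0 ->
  (forall P (x : mor P A), projective C P -> i ∘ x = 0 -> x = 0) ->
  (forall P (y : mor P B), projective C P -> p ∘ y = 0 -> exists x, i ∘ x = y) ->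
  (forall P (z : mor P D), projective C P -> exists y, p ∘ y = z) ->
  short_exact i p.
Proof.
move=> pi0 /mono_test im pilift /epi_test pe.
have [K [k kp]] := epi_ses pe; have [h kh] := ses_lift kp pi0.
have [||h' [h'h hh']] := @mono_epi_iso _ _ h.
- by move=> T x y hxy; apply: im; rewrite -kh -!compcA hxy.
- apply: epi_test => P x Pp; have [|y iy] := pilift P (k ∘ x) Pp.
    by rewrite compcA (ses_comp0 kp) comp0c.
  by exists y; apply: (ses_mono kp); rewrite compcA kh.
apply: kernel_ses => //; apply: mono_kernel => // T g pg0.
have [x kx] := ses_lift kp pg0; exists (h' ∘ x).
by rewrite -kh -compcA (compcA h) hh' compc1l.
Qed.

(** For [f] a projective cover of [D] with kernel [K], the object [E] is at once an extension of [T]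
    by [A] and of [B] by [K]. This carries most of the dimension shifting below. *)
Lemma pullback_ses A B D T (i : mor A B) (p : mor B D) (f : mor T D) :
  short_exact i p ->
  exists E (j : mor A E) (r : mor E T) (g : mor E B),
    [/\ short_exact j r, g ∘ j = i, p ∘ g = f ∘ r
      & forall K (k : mor K T), short_exact k f ->
          exists k' : mor K E, short_exact k' g /\ r ∘ k' = k].
Proof.
move=> ip; have [E [g [r [pg _ univ E0]]]] := pullback f (ses_epi ip).
have [|j [gj rj]] := univ A i 0; first by rewrite (ses_comp0 ip) compc0.
exists E, j, r, g; split=> // [|K k kf].
  apply: ses_test => // [P x Pp jx|P y Pp ry|P z Pp].
  - by apply: (mono_eq0 (ses_mono ip)); rewrite -gj -compcA jx compc0.
  - have [|x ix] := ses_lift (g := g ∘ y) ip.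
      by rewrite compcA pg -compcA ry compc0.
    exists x; apply/eqP; rewrite -subr_eq0; apply/eqP; apply: E0.
      by rewrite compcB compcA gj ix subrr.
    by rewrite compcB compcA rj ry comp0c subrr.
  - have [y py] := Pp _ _ p (f ∘ z) (ses_epi ip).
    by have [w [_ rw]] := univ _ _ _ py; exists w.
have [|k' [gk' rk']] := univ K 0 k; first by rewrite (ses_comp0 kf) compc0.
exists k'; split=> //; apply: ses_test => // [P x Pp k'x|P y Pp gy|P z Pp].
- by apply: (mono_eq0 (ses_mono kf)); rewrite -rk' -compcA k'x compc0.
- have [|x kx] := ses_lift (g := r ∘ y) kf.
    by rewrite compcA -pg -compcA gy compc0.
  exists x; apply/eqP; rewrite -subr_eq0; apply/eqP; apply: E0.
    by rewrite compcB compcA gk' gy comp0c subrr.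
  by rewrite compcB compcA rk' kx subrr.
- have [y fy] := Pp _ _ f (p ∘ z) (ses_epi kf).
  by have [w [gw _]] := univ _ _ _ (esym fy); exists w.
Qed.

(** [E] is the cokernel of [i1 ∘ f - i2 ∘ i], a monomorphism because [f] is one. *)
Lemma pushout_ses A B D T (i : mor A B) (p : mor B D) (f : mor A T) :
  short_exact i p -> mono f ->
  exists E (j : mor T E) (r : mor E D) (g : mor B E),
    [/\ short_exact j r, j ∘ f = g ∘ i
      & forall Q (q : mor T Q), short_exact f q ->
          exists q' : mor E Q, short_exact g q'].
Proof.
move=> ip fm; have [S [i1 [i2 [p1 [p2 [p1i1 p2i2 p2i1 p1i2 sumE]]]]]] :=
  ab_biproduct (abP C) T B.
pose h := i1 ∘ f - i2 ∘ i.
have p1h : p1 ∘ h = f by rewrite compcB !compcA p1i1 p1i2 comp0c subr0 compc1l.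
have p2h : p2 ∘ h = - i by rewrite compcB !compcA p2i1 p2i2 comp0c sub0r compc1l.
have hm : mono h by move=> U x y xy; apply: fm; rewrite -p1h -!compcA xy.
have [E [c hc]] := mono_ses hm; have ce := ses_epi hc.
have jfgi : c ∘ i1 ∘ f = c ∘ i2 ∘ i.
  by apply/eqP; rewrite -subr_eq0 -!compcA -compcB (ses_comp0 hc).
have [|r rc] := ses_desc (g := p ∘ p2) hc.
  by rewrite -compcA p2h compcN (ses_comp0 ip) oppr0.
have rj : r ∘ (c ∘ i1) = 0 by rewrite compcA rc -compcA p2i1 compc0.
exists E, (c ∘ i1), r, (c ∘ i2); split=> // [|Q q fq].
  apply: ses_test => // [P x Pp jx|P y Pp ry|P z Pp].
  - have [|w hw] := ses_lift (g := i1 ∘ x) hc; first by rewrite compcA.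
    have w0 : w = 0.
      apply: (mono_eq0 (ses_mono ip)); apply: oppr_inj.
      by rewrite -compNc -p2h -compcA hw compcA p2i1 comp0c oppr0.
    by rewrite -[x]compc1l -p1i1 -compcA -hw w0 !compc0.
  - have [w cw] := Pp _ _ c y ce.
    have [|a ia] := ses_lift (g := p2 ∘ w) ip; first by rewrite compcA -rc -compcA cw.
    exists (p1 ∘ w + f ∘ a).
    rewrite compcDr (compcA _ f) jfgi -(compcA _ i) ia -!compcA -compcDr !compcA.
    by rewrite -compcDl sumE compc1l.
  - have [w pw] := Pp _ _ p z (ses_epi ip); exists (c ∘ i2 ∘ w).
    by rewrite !compcA rc -(compcA p) p2i2 compc1r.
have [|q' q'c] := ses_desc (g := q ∘ p1) hc; first by rewrite -compcA p1h (ses_comp0 fq).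
have q'g : q' ∘ (c ∘ i2) = 0 by rewrite compcA q'c -compcA p1i2 compc0.
exists q'; apply: ses_test => // [P x Pp gx|P y Pp q'y|P z Pp].
- have [|w hw] := ses_lift (g := i2 ∘ x) hc; first by rewrite compcA.
  have w0 : w = 0.
    by apply: (mono_eq0 fm); rewrite -p1h -compcA hw compcA p1i2 comp0c.
  by rewrite -[x]compc1l -p2i2 -compcA -hw w0 !compc0.
- have [w cw] := Pp _ _ c y ce.
  have [|a fa] := ses_lift (g := p1 ∘ w) fq; first by rewrite compcA -q'c -compcA cw.
  exists (p2 ∘ w + i ∘ a).
  rewrite compcDr (compcA _ i) -jfgi -(compcA _ f) fa -!compcA -compcDr !compcA.
  by rewrite -compcDl addrC sumE compc1l.
- have [w qw] := Pp _ _ q z (ses_epi fq); exists (c ∘ i1 ∘ w).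
  by rewrite !compcA q'c -(compcA q) p1i1 compc1r.
Qed.

(** [K] is the preimage of [A] in [N]. With [N] projective it compares the syzygies [L] of [M] and
    [K] of [D]. *)
Lemma epi_comp_ses L N M A D (l : mor L N) (p : mor N M) (i : mor A M) (q : mor M D) :
  short_exact l p -> short_exact i q ->
  exists K (k : mor K N) (u : mor L K) (v : mor K A),
    [/\ short_exact k (q ∘ p), short_exact u v, i ∘ v = p ∘ k & k ∘ u = l].
Proof.
move=> lp iq; have [K [k kqp]] := epi_ses (comp_epi (ses_epi iq) (ses_epi lp)).
have qpk := ses_comp0 kqp.
have [|u ku] := ses_lift (g := l) kqp; first by rewrite -compcA (ses_comp0 lp) compc0.
have [|v iv] := ses_lift (g := p ∘ k) iq; first by rewrite compcA.
exists K, k, u, v; split=> //; apply: ses_test => [|P x Pp ux|P y Pp vy|P z Pp].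
- by apply: (mono_eq0 (ses_mono iq)); rewrite compcA iv -compcA ku (ses_comp0 lp).
- by apply: (mono_eq0 (ses_mono lp)); rewrite -ku -compcA ux compc0.
- have [|x lx] := ses_lift (g := k ∘ y) lp; first by rewrite compcA -iv -compcA vy compc0.
  by exists x; apply: (ses_mono kqp); rewrite compcA ku.
- have [y py] := Pp _ _ p (i ∘ z) (ses_epi lp).
  have [|x kx] := ses_lift (g := y) kqp.
    by rewrite -compcA py compcA (ses_comp0 iq) comp0c.
  by exists x; apply: (ses_mono iq); rewrite compcA iv -compcA kx.
Qed.

(** The third isomorphism theorem: [A = N/L], [Q = M/L] and [D = M/N]. *)
Lemma mono_comp_ses L N M A D (l : mor L N) (p : mor N A) (i : mor N M) (q : mor M D) :
  short_exact l p -> short_exact i q ->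
  exists Q (c : mor M Q) (u : mor A Q) (v : mor Q D),
    short_exact (i ∘ l) c /\ short_exact u v.
Proof.
move=> lp iq; have [Q [c lc]] := mono_ses (comp_mono (ses_mono iq) (ses_mono lp)).
have [|u up] := ses_desc (g := c ∘ i) lp; first by rewrite -compcA (ses_comp0 lc).
have [|v vc] := ses_desc (g := q) lc; first by rewrite compcA (ses_comp0 iq) comp0c.
have vu0 : v ∘ u = 0.
  by apply: (epi_eq0 (ses_epi lp)); rewrite -compcA up compcA vc (ses_comp0 iq).
exists Q, c, u, v; split=> //; apply: ses_test => // [P x Pp ux|P y Pp vy|P z Pp].
- have [y py] := Pp _ _ p x (ses_epi lp).
  have [|w lw] := ses_lift (g := i ∘ y) lc; first by rewrite compcA -up -compcA py.
  have -> : x = p ∘ (l ∘ w).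
    by rewrite -py; congr (_ ∘ _); apply: (ses_mono iq); rewrite -lw compcA.
  by rewrite compcA (ses_comp0 lp) comp0c.
- have [w cw] := Pp _ _ c y (ses_epi lc).
  have [|x ix] := ses_lift (g := w) iq; first by rewrite -vc -compcA cw.
  by exists (p ∘ x); rewrite compcA up -compcA ix.
- by have [y qy] := Pp _ _ q z (ses_epi iq); exists (c ∘ y); rewrite compcA vc.
Qed.

End AbelianBasics.

(** * Ext by dimension shifting *)

Section Syzygies.
Variable C : abelian.
Implicit Types A B D E K L M N P S T : C.
Implicit Types XX YY : set C.

(* Dimension shifting turned into a definition: [extn n M N] amounts to
   Ext^(n+1)(M, N) = 0, see [Ext_vanishesP]. *)
Fixpoint extn (n : nat) M N : Prop :=
  forall K P (k : mor K P) (p : mor P M), projective C P -> short_exact k p ->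
    if n is n'.+1 then extn n' K N
    else forall f : mor K N, exists g : mor P N, g ∘ k = f.

Lemma exact_ses L A K B (a : mor L A) (e : mor A K) (k : mor K B) :
  mono k -> exact a (k ∘ e) <-> exact a e.
Proof.
move=> km; split=> -[I [u [i [ue ai ik]]]]; exists I, u, i; split=> //.
  split=> [|T g eg]; last by apply: (proj2 ik); rewrite -compcA eg compc0.
  by apply: (mono_eq0 km); rewrite compcA (proj1 ik).
split=> [|T g]; first by rewrite -compcA (proj1 ik) compc0.
by rewrite -compcA => /(mono_eq0 km); apply: (proj2 ik).
Qed.

Definition splice_ob P (Q : nat -> C) (n : nat) : C := if n is n'.+1 then Q n' else P.

Definition splice_mor P (Q : nat -> C) (d : forall n, mor (Q n.+1) (Q n))
    (a : mor (Q 0) P) (n : nat) : mor (splice_ob P Q n.+1) (splice_ob P Q n) :=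
  match n with 0 => a | n'.+1 => d n' end.

(** Prepending [P] raises every degree by one, which is the shift behind [Ext_vanishesP]. *)
Lemma splice_resolution K P M (k : mor K P) (p : mor P M) Q d (e : mor (Q 0%N) K) :
  short_exact k p -> is_resolution d e ->
  @is_resolution C M (splice_ob P Q) (splice_mor d (k ∘ e)) p.
Proof.
move=> kp [ee ex0 exS]; split=> [||[|n]] //=; first exact: ses_epi kp.
  by exists K, e, k; split=> //; case: kp.
by apply/exact_ses => //; apply: ses_mono kp.
Qed.

Lemma truncate_resolution M Q d (e : mor (Q 0%N) M) :
  is_resolution d e ->
  exists K (k : mor K (Q 0%N)) (e' : mor (Q 1%N) K),
    [/\ short_exact k e, d 0%N = k ∘ e'
      & @is_resolution C K (fun n => Q n.+1) (fun n => d n.+1) e'].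
Proof.
move=> [ee [K [e' [k [e'e dE ke]]]] exS]; exists K, k, e'.
split=> //; first exact: kernel_ses.
by split=> //; apply/(exact_ses _ _ (kernel_mono ke)); rewrite -dE.
Qed.

Lemma exact_desc A B D T (f : mor A B) (g : mor B D) (c : mor B T) :
  exact f g -> epi g -> c ∘ f = 0 -> exists c', c' ∘ g = c.
Proof.
move=> [I [e [i [ee -> /kernel_ses ig]]]] /ig {}ig.
by rewrite compcA => /(epi_eq0 ee) /(ses_desc ig).
Qed.

Hypothesis enoughP : enough_projectives C.

Lemma projective_cover M :
  exists K P (k : mor K P) (p : mor P M), projective C P /\ short_exact k p.
Proof.
have [P [p [Pp /epi_ses [K [k kp]]]]] := enoughP M.
by exists K, P, k, p.
Qed.

Lemma projective_resolution M :
  exists Q d (e : mor (Q 0%N) M), (forall n, projective C (Q n)) /\ is_resolution d e.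
Proof.
have [K HK] := choice projective_cover; have [P HP] := choice HK.
pose k N := sval (cid (HP N)); have Hk N := svalP (cid (HP N)).
pose p N := sval (cid (Hk N)).
have KP N : projective C (P N) /\ short_exact (k N) (p N) := svalP (cid (Hk N)).
(* [S n] is the [n]-th syzygy of [M] for the chosen covers. *)
pose S := fix S n := if n is n'.+1 then K (S n') else M.
exists (fun n => P (S n)), (fun n => k (S n) ∘ p (S n.+1)), (p M); split=> [n|].
  by case: (KP (S n)).
have ex n : exact (k (S n) ∘ p (S n.+1)) (p (S n)).
  exists (S n.+1), (p (S n.+1)), (k (S n)); split=> //.
    by case: (KP (S n.+1)) => _ /ses_epi.
  by case: (KP (S n)) => _ [].
split=> [||n]; [by case: (KP M) => _ /ses_epi|exact: (ex 0%N)|].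
by apply/exact_ses; [case: (KP (S n)) => _ /ses_mono|exact: (ex n.+1)].
Qed.

(** Both sides quantify over all choices. From left to right, a cover is spliced onto a resolution
    of its syzygy; from right to left, a given resolution is truncated. *)
Lemma Ext_vanishesP n M N : Ext_vanishes n.+1 M N <-> extn n M N.
Proof.
elim: n M => [|n IHn] M; split=> extM.
- move=> K P k p Pp kp f; have [Q [d [e [Qp Qres]]]] := projective_resolution K.
  have [||b fb] := extM _ _ _ _ (splice_resolution kp Qres) (f ∘ e); first by case.
    rewrite /cocycle /= -compcA.
    case: Qres => _ [I [u [i [_ -> [ei0 _]]]]] _.
    by rewrite (compcA e) ei0 comp0c compc0.
  exists b; case: Qres => ee _ _; apply: ee.
  by rewrite -compcA; apply: esym.
- move=> Q d e Qp /truncate_resolution [K [k [e' [ke dE [e'e ex0 _]]]]] c cc.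
  have [f fc] := exact_desc ex0 e'e cc.
  have [g gk] := extM _ _ _ _ (Qp 0%N) ke f.
  by exists g; rewrite dE compcA gk fc.
- move=> K P k p Pp kp; apply/IHn => Q d e Qp Qres c cc.
  apply: (extM _ _ _ _ (splice_resolution kp Qres)); last exact: cc.
  by case.
- move=> Q d e Qp /truncate_resolution [K [k [e' [ke dE res]]]] c cc.
  have /IHn extK := extM _ _ _ _ (Qp 0%N) ke.
  by apply: (extK _ _ _ _ res c cc) => i; apply: Qp.
Qed.

(** A lift [g0] exists on a projective cover of [M]. On the syzygy it takes values in [N], and
    extending that restriction to the cover gives the correction making [g0] descend to [M]. *)
Lemma ext1_lift N B D M (i : mor N B) (p : mor B D) (f : mor M D) :
  extn 0 M N -> short_exact i p -> exists g, p ∘ g = f.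
Proof.
move=> extM ip; have [K [P [k [q [Pp kq]]]]] := projective_cover M.
have [g0 pg0] := Pp _ _ p (f ∘ q) (ses_epi ip).
have [|h ih] := ses_lift (g := g0 ∘ k) ip.
  by rewrite compcA pg0 -compcA (ses_comp0 kq) compc0.
have [g1 g1k] := extM _ _ _ _ Pp kq h.
have [|g gq] := ses_desc (g := g0 - i ∘ g1) kq.
  by rewrite compBc -ih -g1k compcA subrr.
exists g; apply: (ses_epi kq); rewrite -compcA gq compcB pg0 compcA.
by rewrite (ses_comp0 ip) comp0c subr0.
Qed.

(** Pulled back to a projective cover [P] of [D], the sequence splits, so [f] extends to [E]. A term
    [b ∘ r] coming from [P] then makes the extension vanish on the kernel of [E -> B]. *)
Lemma ext1_extend A B D N (i : mor A B) (p : mor B D) (f : mor A N) :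
  extn 0 D N -> short_exact i p -> exists g, g ∘ i = f.
Proof.
move=> extD ip; have [K [P [k [q [Pp kq]]]]] := projective_cover D.
have [E [j [r [g [jr gj _ kk]]]]] := pullback_ses enoughP q ip.
have [k' [k'g rk']] := kk _ _ kq.
have [t rt] := Pp _ _ r (idc P) (ses_epi jr).
have [ρ ρj] := ses_retract jr rt.
have [b bk] := extD _ _ _ _ Pp kq (- (f ∘ ρ ∘ k')).
have [|h hg] := ses_desc (g := f ∘ ρ + b ∘ r) k'g.
  by rewrite compcDl -(compcA b) rk' bk subrr.
exists h; rewrite -gj compcA hg compcDl -!compcA ρj (ses_comp0 jr).
by rewrite compc0 addr0 compc1r.
Qed.

Lemma split_projective A B D (i : mor A B) (p : mor B D) :
  projective C D -> short_exact i p -> exists r, r ∘ i = idc A.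
Proof.
move=> Dp ip; have [s ps] := Dp _ _ p (idc D) (ses_epi ip).
exact: ses_retract ip ps.
Qed.

Lemma projective_retract A B (s : mor A B) (r : mor B A) :
  r ∘ s = idc A -> projective C B -> projective C A.
Proof.
move=> rs Bp S T p f pe; have [g pg] := Bp _ _ p (f ∘ r) pe.
by exists (g ∘ s); rewrite compcA pg -compcA rs compc1r.
Qed.

Lemma projective_syzygy A B D (i : mor A B) (p : mor B D) :
  short_exact i p -> projective C B -> projective C D -> projective C A.
Proof.
move=> ip Bp /split_projective /(_ ip) [r ri].
exact: projective_retract ri Bp.
Qed.

Lemma extn_projective n M N : projective C M -> extn n M N.
Proof.
elim: n M => [|n IHn] M Mp K P k p Pp kp.
  have [r rk] := split_projective Mp kp.
  by move=> f; exists (f ∘ r); rewrite -compcA rk compc1r.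
exact/IHn/(projective_syzygy kp).
Qed.

Lemma projectiveP M : projective C M <-> forall N, extn 0 M N.
Proof.
split=> [Mp N|ext0 A B p f pe]; first exact: extn_projective.
by have [K [k kp]] := epi_ses pe; exact: ext1_lift (ext0 K) kp.
Qed.

(** The syzygy [K] of [A] is exhibited as a retract of a syzygy [K'] of [B]: pull [p] back along
    [r], cover the result by a projective [P'], and lift to [P'] the section of [u] given by [idc P]
    and [s ∘ p]. Both cases of the induction share this construction. *)
Lemma extn_retract n A B N (s : mor A B) (r : mor B A) :
  r ∘ s = idc A -> extn n B N -> extn n A N.
Proof.
elim: n A B s r => [|n IHn] A B s r rs extB K P k p Pp kp.
all: have [E [u [v [pu ve univ _]]]] := pullback r (ses_epi kp).
all: have [|σ [uσ vσ]] := univ _ (idc P) (s ∘ p); first by rewrite compcA rs compc1l compc1r.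
all: have [P' [y [P'p ye]]] := enoughP E; have [τ yτ] := Pp _ _ y σ ye.
all: have [K' [w wvy]] := epi_ses (comp_epi ve ye).
all: have [|a ka] := ses_lift (g := u ∘ y ∘ w) kp;
  first by rewrite !compcA pu -!compcA (compcA v) (ses_comp0 wvy) compc0.
all: have [|b wb] := ses_lift (g := τ ∘ k) wvy;
  first by rewrite compcA -(compcA v) yτ vσ -compcA (ses_comp0 kp) compc0.
all: have ab : a ∘ b = idc K by
  apply: (ses_mono kp); rewrite compcA ka -compcA wb compcA -(compcA u) yτ uσ compc1l compc1r.
- move=> f; have [g gw] := extB _ _ _ _ P'p wvy (f ∘ a).
  by exists (g ∘ τ); rewrite -compcA -wb compcA gw -compcA ab compc1r.
- exact: IHn ab (extB _ _ _ _ P'p wvy).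
Qed.

(** A map on the syzygy [L] of [B] extends to the syzygy [K] of [D] because [K/L] is [A], and from
    there to [P]. *)
Lemma ext1_extension A B D N (i : mor A B) (p : mor B D) :
  short_exact i p -> extn 0 A N -> extn 0 D N -> extn 0 B N.
Proof.
move=> ip extA extD L P l q Pp lq f.
have [K [k [u [v [kpq uv _ ku]]]]] := epi_comp_ses enoughP lq ip.
have [g gu] := ext1_extend f extA uv.
by have [h hk] := extD _ _ _ _ Pp kpq g; exists h; rewrite -ku compcA hk.
Qed.

(** The two closures feed each other. Extensions in degree [m] give epikernels in degree [m], since
    [A] is a retract of an extension of [B] by a syzygy of [D]. Epikernels in degree [n] give
    extensions in degree [n.+1], since the syzygy [L] of [B] is the kernel of an epimorphism from a
    syzygy of [D] onto [A]. *)
Lemma extn_extension_epikernel n :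
  (forall A B D N (i : mor A B) (p : mor B D),
    short_exact i p -> extn n A N -> extn n D N -> extn n B N) /\
  (forall A B D N (i : mor A B) (p : mor B D),
    short_exact i p -> extn n B N -> extn n.+1 D N -> extn n A N).
Proof.
have step m : (forall A B D N (i : mor A B) (p : mor B D),
    short_exact i p -> extn m A N -> extn m D N -> extn m B N) ->
  (forall A B D N (i : mor A B) (p : mor B D),
    short_exact i p -> extn m B N -> extn m.+1 D N -> extn m A N).
  move=> ext A B D N i p ip extB extD.
  have [K [P [k [q [Pp kq]]]]] := projective_cover D.
  have [E [j [r [g [jr _ _ kk]]]]] := pullback_ses enoughP q ip.
  have [k' [k'g _]] := kk _ _ kq; have [ρ ρj] := split_projective Pp jr.
  by apply: extn_retract ρj _; apply: ext k'g _ extB; apply: extD Pp kq.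
elim: n => [|n [ext epik]]; first by split; [|apply: step]; apply: ext1_extension.
suff ext' : forall A B D N (i : mor A B) (p : mor B D),
  short_exact i p -> extn n.+1 A N -> extn n.+1 D N -> extn n.+1 B N.
  by split=> //; apply: step.
move=> A B D N i p ip extA extD L P l q Pp lq.
have [K [k [u [v [kpq uv _ _]]]]] := epi_comp_ses enoughP lq ip.
by apply: epik uv _ extA; apply: extD Pp kpq.
Qed.

Lemma extn_extension n A B D N (i : mor A B) (p : mor B D) :
  short_exact i p -> extn n A N -> extn n D N -> extn n B N.
Proof. by have [ext _] := extn_extension_epikernel n; apply: ext. Qed.

Lemma extn_epikernel n A B D N (i : mor A B) (p : mor B D) :
  short_exact i p -> extn n B N -> extn n.+1 D N -> extn n A N.
Proof. by have [_ epik] := extn_extension_epikernel n; apply: epik. Qed.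

(** A syzygy [K] of [D] is the kernel of [E -> B], where [E] is an extension of a projective by
    [A]. *)
Lemma extn_monocokernel n A B D N (i : mor A B) (p : mor B D) :
  short_exact i p -> extn n A N -> extn n.+1 B N -> extn n.+1 D N.
Proof.
move=> ip extA extB K P k q Pp kq.
have [E [j [r [g [jr _ _ kk]]]]] := pullback_ses enoughP q ip.
have [k' [k'g _]] := kk _ _ kq; apply: extn_epikernel k'g _ extB.
by apply: extn_extension jr extA _; apply: extn_projective.
Qed.

Lemma ext1_extension_r A B D M (i : mor A B) (p : mor B D) :
  short_exact i p -> extn 0 M A -> extn 0 M D -> extn 0 M B.
Proof.
move=> ip extA extD K P k q Pp kq f.
have [g gk] := extD _ _ _ _ Pp kq (p ∘ f).
have [h ph] := Pp _ _ p g (ses_epi ip).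
have [|a ia] := ses_lift (g := f - h ∘ k) ip.
  by rewrite compcB compcA ph gk subrr.
have [b bk] := extA _ _ _ _ Pp kq a; exists (h + i ∘ b).
by rewrite compcDl -compcA bk ia addrC subrK.
Qed.

Lemma ext1_retract_r M A B (s : mor A B) (r : mor B A) :
  r ∘ s = idc A -> extn 0 M B -> extn 0 M A.
Proof.
move=> rs extB K P k p Pp kp f; have [g gk] := extB _ _ _ _ Pp kp (s ∘ f).
by exists (r ∘ g); rewrite -compcA gk compcA rs compc1l.
Qed.

(** The condition on [K] amounts to Ext^2([M], [A]) = 0: it lifts [f] to [B], and the condition on
    [B] extends the lift to [P]. *)
Lemma ext1_monocokernel_r A B D K P M (i : mor A B) (p : mor B D)
    (k : mor K P) (q : mor P M) :
  short_exact i p -> short_exact k q -> projective C P ->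
  extn 0 K A -> extn 0 M B -> forall f : mor K D, exists g, g ∘ k = f.
Proof.
move=> ip kq Pp extA extB f; have [g pg] := ext1_lift f extA ip.
have [h hk] := extB _ _ _ _ Pp kq g.
by exists (p ∘ h); rewrite -compcA hk.
Qed.

End Syzygies.

(** * Cotorsion pairs and finite resolutions *)

Section FiniteResolutions.
Variable C : abelian.
Implicit Types A B D K M N T : C.
Implicit Types XX YY AA DD : set C.

Lemma zero_object_projective A : zero_object C A -> projective C A.
Proof.
by move=> A0 B D p f _; exists 0; rewrite compc0 (proj1 (A0 D) f).
Qed.

Lemma exact_zero_object Z B (g : mor Z B) : zero_object C Z -> exact (0 : mor Z Z) g.
Proof.
move=> Z0; exists Z, (idc Z), (idc Z); split.
- by move=> T x y; rewrite !compc1r.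
- by rewrite compc1l (proj1 (Z0 Z) (idc Z)).
- apply: mono_kernel => [T x y||T x _]; first by rewrite !compc1l.
    by rewrite compc1r (proj1 (Z0 B) g).
  by exists x; rewrite compc1l.
Qed.

Lemma fin_res0 XX M :
  fin_res XX 0 M <-> exists A (f : mor A M), XX A /\ is_iso f.
Proof.
split=> [[A [d [e [[ee [I [u [i [ue dE ie]]]] _] XA A0]]]]|[A [f [XA fi]]]].
  exists (A 0%N), e; split; first exact: XA.
  apply: mono_epi_iso => // T g h; move=> eg; apply/eqP; rewrite -subr_eq0.
  have [|x ix] := kernel_lift (g := g - h) ie; first by rewrite compcB eg subrr.
  (* The image of [d 0] is zero, as [A 1] is a zero object; so [e] has zero kernel. *)
  have i0 : i = 0.
    by apply: (epi_eq0 ue); rewrite -dE (proj1 (A0 1%N isT (A 0%N)) (d 0%N)).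
  by rewrite -ix i0 comp0c.
have [Z Z0] := ab_zero (abP C).
exists (splice_ob A (fun=> Z)), (@splice_mor C A (fun=> Z) (fun=> 0) 0), f.
split=> [|[]|[]] //; split=> [||[|n]] /=; [exact: iso_epi| |exact: exact_zero_object..].
exists Z, (idc Z), 0; split; first by move=> T x y; rewrite !compc1r.
  by rewrite comp0c.
apply: mono_kernel => [T x y||T x fx]; last 2 first.
- by rewrite compc0.
- by exists 0; rewrite compc0 (mono_eq0 (iso_mono fi) fx).
by rewrite (proj2 (Z0 T) x) (proj2 (Z0 T) y).
Qed.

Lemma fin_resS XX n M :
  fin_res XX n.+1 M <-> exists K A (k : mor K A) (p : mor A M),
    [/\ short_exact k p, XX A & fin_res XX n K].
Proof.
split=> [[A [d [e [/truncate_resolution [K [k [e' [ke _ res]]]] XA A0]]]]|].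
  exists K, (A 0%N), k, e; split=> //; first exact: XA.
  exists (fun i => A i.+1), (fun i => d i.+1), e'.
  by split=> // i ni; [exact: (XA i.+1)|exact: (A0 i.+1)].
move=> [K [A [k [p [kp XA [B [d [e [res XB B0]]]]]]]]].
exists (splice_ob A B), (splice_mor d (k ∘ e)), p.
by split; [exact: splice_resolution|case|case].
Qed.

Lemma fin_res_sub XX YY n : XX `<=` YY -> fin_res XX n `<=` fin_res YY n.
Proof.
move=> XY M [A [d [e [res XA A0]]]]; exists A, d, e.
by split=> // i ni; apply/XY/XA.
Qed.

Lemma sub_fin_res XX n : zero_object C `<=` XX -> XX `<=` fin_res XX n.
Proof.
move=> X0 M XM.
have : exists A (f : mor A M), XX A /\ is_iso f.
  by exists M, (idc M); split=> //; exists (idc M); rewrite compc1l.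
elim: n M {XM} => [|n IHn] M; first by move/fin_res0.
move=> [A [f [XA fi]]]; apply/fin_resS.
have [Z [z [Z0 zid]]] := ses_idr A; exists Z, A, z, f; split=> //.
  apply: kernel_ses (iso_epi fi); apply: mono_kernel; first exact: ses_mono zid.
    by rewrite (proj1 (Z0 A) z) compc0.
  by move=> T x /(mono_eq0 (iso_mono fi)) ->; exists 0; rewrite compc0.
apply: IHn; exists Z, (idc Z); split; first exact: X0.
by exists (idc Z); rewrite compc1l.
Qed.

Hypothesis enoughP : enough_projectives C.

Lemma perp_1P XX N : perp_ 1 XX N <-> forall M, XX M -> extn 0 M N.
Proof. by split=> XN M XM; apply/(Ext_vanishesP enoughP); apply: XN. Qed.

Lemma lperp_1P XX M : lperp_ 1 XX M <-> forall N, XX N -> extn 0 M N.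
Proof. by split=> XM N XN; apply/(Ext_vanishesP enoughP); apply: XM. Qed.

Lemma perpP XX N : perp XX N <-> forall n M, XX M -> extn n M N.
Proof.
split=> XN; first by move=> n M XM; apply/(Ext_vanishesP enoughP); apply: XN.
by move=> [|n] // _ M XM; apply/(Ext_vanishesP enoughP); apply: XN.
Qed.

Lemma hereditary_pairP AA DD :
  hereditary_pair AA DD <-> forall n M N, AA M -> DD N -> extn n M N.
Proof.
split=> her.
  by move=> n M N AM DN; apply/(Ext_vanishesP enoughP); apply: her.
by move=> M N AM DN [|n] // _; apply/(Ext_vanishesP enoughP); apply: her.
Qed.

Lemma cotorsion_pairP AA DD : cotorsion_pair AA DD <->
  (forall N, DD N <-> forall M, AA M -> extn 0 M N) /\
  (forall M, AA M <-> forall N, DD N -> extn 0 M N).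
Proof.
split=> [[DE AE]|[DP AP]].
  split=> [N|M]; first by rewrite -{1}DE; apply: perp_1P.
  by rewrite {1}AE; apply: lperp_1P.
split; apply/seteqP; split=> M.
- by move/perp_1P => /DP.
- by move/DP => ?; apply/perp_1P.
- by move/AP => ?; apply/lperp_1P.
- by move/lperp_1P => /AP.
Qed.

(** Syzygies of objects of [AA] stay in [AA], so orthogonality in degree 1 shifts to all degrees. *)
Lemma closed_syzygies_hereditary AA DD :
  (forall M N, AA M -> DD N -> extn 0 M N) ->
  closed_epikernels AA -> projective C `<=` AA -> hereditary_pair AA DD.
Proof.
move=> orth epik PA; apply/hereditary_pairP; elim=> [|n IHn] M N AM DN; first exact: orth.
by move=> K P k p /PA AP kp; apply: IHn DN; apply: epik kp AP AM.
Qed.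

(** * Closure properties of a cotorsion pair and of bounded dimension *)

Section CotorsionPair.
Variables AA DD : set C.
Hypothesis cotAD : cotorsion_pair AA DD.

Lemma cotorsion_l M : AA M <-> forall N, DD N -> extn 0 M N.
Proof. by case/cotorsion_pairP: cotAD. Qed.

Lemma cotorsion_r N : DD N <-> forall M, AA M -> extn 0 M N.
Proof. by case/cotorsion_pairP: cotAD. Qed.

Lemma cotorsion_orth M N : AA M -> DD N -> extn 0 M N.
Proof. by move/cotorsion_l; apply. Qed.

Lemma projective_cotorsion_l : projective C `<=` AA.
Proof. by move=> M Mp; apply/cotorsion_l => N _; apply: extn_projective. Qed.

Lemma zero_cotorsion_l : zero_object C `<=` AA.
Proof. by move=> A /zero_object_projective /projective_cotorsion_l. Qed.

Lemma zero_cotorsion_r : zero_object C `<=` DD.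
Proof.
move=> N N0; apply/cotorsion_r => M _ K P k p _ _ f.
by exists 0; rewrite comp0c (proj2 (N0 K) f).
Qed.

Lemma cotorsion_l_extensions : closed_extensions AA.
Proof.
move=> A B D i p ip AA_A AA_D; apply/cotorsion_l => N DN.
by apply: (ext1_extension enoughP ip); apply: cotorsion_orth.
Qed.

Lemma cotorsion_r_extensions : closed_extensions DD.
Proof.
move=> A B D i p ip DA DDD; apply/cotorsion_r => M AM.
by apply: (ext1_extension_r ip); apply: cotorsion_orth.
Qed.

Lemma cotorsion_l_retract A B (s : mor A B) (r : mor B A) :
  r ∘ s = idc A -> AA B -> AA A.
Proof.
move=> rs AB; apply/cotorsion_l => N DN.
by apply: (extn_retract enoughP rs); apply: cotorsion_orth.
Qed.

Lemma cotorsion_r_retract A B (s : mor A B) (r : mor B A) :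
  r ∘ s = idc A -> DD B -> DD A.
Proof.
move=> rs DB; apply/cotorsion_r => M AM.
by apply: (ext1_retract_r rs); apply: cotorsion_orth.
Qed.

Hypothesis herAD : hereditary_pair AA DD.

Lemma hereditary_epikernels : closed_epikernels AA.
Proof.
have her := proj1 (hereditary_pairP AA DD) herAD.
move=> A B D i p ip AB ADD; apply/cotorsion_l => N DN.
by apply: (extn_epikernel enoughP ip); apply: her.
Qed.

(** The obstruction is Ext^2([M], [A]), which is Ext^1 from a syzygy of [M], again in [AA]. *)
Lemma hereditary_monocokernels : closed_monocokernels DD.
Proof.
move=> A B D i p ip DA DB; apply/cotorsion_r => M AM K P k q Pp kq.
apply: (ext1_monocokernel_r enoughP ip kq Pp); apply: cotorsion_orth => //.
exact: hereditary_epikernels kq (projective_cotorsion_l Pp) AM.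
Qed.

Lemma hereditary_perp : perp AA = DD.
Proof.
apply/seteqP; split=> N; first by move/perpP => AN; apply/cotorsion_r/AN.
by move=> DN; apply/perpP => n M AM; apply: (proj1 (hereditary_pairP AA DD)).
Qed.

(** In degree 0 the condition says that [M] is in [AA], where heredity applies; higher degrees
    reduce to it through syzygies. *)
Lemma ext_closed_succ n M :
  (forall N, DD N -> extn n M N) -> forall N, DD N -> extn n.+1 M N.
Proof.
elim: n M => [|n IHn] M extM N DN.
  by apply: (proj1 (hereditary_pairP AA DD)) => //; apply/cotorsion_l.
move=> K P k p Pp kp; apply: IHn DN => N' DN'.
exact: extM Pp kp.
Qed.

(** Bounded dimension becomes Ext vanishing, from which its closure properties follow. To build a
    resolution from the vanishing, projective covers suffice, since projectives lie in [AA]. *)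
Lemma fin_resP n M : fin_res AA n M <-> forall N, DD N -> extn n M N.
Proof.
have her := proj1 (hereditary_pairP AA DD) herAD.
elim: n M => [|n IHn] M.
  split=> [/fin_res0 [A [f [AA_A [g [gf fg]]]]] N DN|/cotorsion_l AM].
    by apply: (extn_retract enoughP fg); apply: cotorsion_orth.
  by apply: sub_fin_res AM; apply: zero_cotorsion_l.
split=> [/fin_resS [K [A [k [p [kp AA_A /IHn extK]]]]] N DN|extM].
  by apply: (extn_monocokernel enoughP kp); [apply: extK|apply: her].
have [K [P [k [p [Pp kp]]]]] := projective_cover enoughP M.
apply/fin_resS; exists K, P, k, p; split=> //; first exact: projective_cotorsion_l.
by apply/IHn => N DN; apply: extM kp.
Qed.

Lemma fin_res_extensions n : closed_extensions (fin_res AA n).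
Proof.
move=> A B D i p ip /fin_resP extA /fin_resP extD; apply/fin_resP => N DN.
by apply: (extn_extension enoughP ip); [apply: extA|apply: extD].
Qed.

Lemma fin_res_epikernels n : closed_epikernels (fin_res AA n).
Proof.
move=> A B D i p ip /fin_resP extB /fin_resP extD; apply/fin_resP => N DN.
by apply: (extn_epikernel enoughP ip); [apply: extB|apply: ext_closed_succ].
Qed.

Lemma fin_res_retract n A B (s : mor A B) (r : mor B A) :
  r ∘ s = idc A -> fin_res AA n B -> fin_res AA n A.
Proof.
move=> rs /fin_resP extB; apply/fin_resP => N DN.
by apply: (extn_retract enoughP rs); apply: extB.
Qed.

(* [D -> A -> M] a special approximation: [D] has smaller dimension than [M]. *)
Lemma fin_res_perp n : complete_pair AA DD ->
  fin_res AA n `&` DD `<=` fin_res (AA `&` DD) n.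
Proof.
move=> complAD; elim: n => [|n IHn] M [resM DM].
  apply: sub_fin_res; first by
    move=> Z Z0; split; [apply: zero_cotorsion_l|apply: zero_cotorsion_r].
  split=> //; move/fin_res0: resM => [A [f [AA_A [g [_ fg]]]]].
  exact: cotorsion_l_retract fg AA_A.
have [[A [D [i [p [ip AA_A DDD]]]]] _] := complAD M.
apply/fin_resS; exists D, A, i, p; split=> //.
  by split=> //; apply: cotorsion_r_extensions ip DDD DM.
apply: IHn; split=> //; apply/fin_resP => N DN.
apply: (extn_epikernel enoughP ip).
  by apply: (proj1 (hereditary_pairP AA DD)).
by move/fin_resP: resM; apply.
Qed.

(** By induction along the resolution, because [DD] is closed under cokernels of monomorphisms. *)
Lemma fin_res_sub_perp n : fin_res (AA `&` DD) n `<=` DD.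
Proof.
elim: n => [|n IHn] M.
  by move/fin_res0 => [A [f [[_ DA] [g [_ fg]]]]]; apply: cotorsion_r_retract fg DA.
move/fin_resS => [K [A [k [p [kp [_ DA] /IHn DK]]]]].
exact: hereditary_monocokernels kp DK DA.
Qed.

End CotorsionPair.

(** Makes the results on [fin_res] available for projective dimension. *)
Lemma projective_cotorsion_pair : cotorsion_pair (projective C) setT.
Proof.
apply/cotorsion_pairP; split=> M; last first.
  split=> [/(projectiveP enoughP) ext0 N _|ext0]; first exact: ext0.
  by apply/(projectiveP enoughP) => N; apply: ext0.
by split=> // _ N Np; apply: extn_projective.
Qed.

Lemma projective_hereditary_pair : hereditary_pair (projective C) setT.
Proof. by apply/hereditary_pairP => n M N Mp _; apply: extn_projective. Qed.

End FiniteResolutions.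

(** * The Hovey triple *)

Section FrobeniusCotorsion.
Variables (C : abelian) (X : set C) (m : nat).
Hypothesis enoughP : enough_projectives C.
Hypothesis ctpX : complete_cotorsion_pair X (perp X).
Hypothesis herX : hereditary_pair X (perp X).

Let cotX : cotorsion_pair X (perp X) := proj1 ctpX.

Lemma perp_retract A B (s : mor A B) (r : mor B A) :
  r ∘ s = idc A -> perp X B -> perp X A.
Proof. exact: (cotorsion_r_retract enoughP cotX). Qed.

Lemma perp_thick : closed_epikernels (perp X) -> thick (perp X).
Proof.
split=> //; first exact: (cotorsion_r_extensions enoughP cotX).
  exact: (hereditary_monocokernels enoughP cotX herX).
by move=> A B S i1 i2 p1 p2 [p1i1 _ _ _ _]; exact: perp_retract p1i1.
Qed.

Section CompletePair.
Hypothesis ctpw : complete_cotorsion_pair (fin_res (X `&` perp X) m)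
              (perp_ 1 (fin_res (X `&` perp X) m)).

(** Membership in [perp X] is the substantial half: projectives lie in the left class of [ctpw],
    which is contained in [perp X]. *)
Lemma projective_sub_core : projective C `<=` X `&` perp X.
Proof.
move=> P Pp; split; first exact: (projective_cotorsion_l enoughP cotX).
apply: (fin_res_sub_perp enoughP cotX herX (n := m)).
exact: (projective_cotorsion_l enoughP (proj1 ctpw)).
Qed.

Lemma core_sub_fin_res : X `&` perp X `<=` fin_res (X `&` perp X) m.
Proof.
by apply: sub_fin_res => Z /zero_object_projective; apply: projective_sub_core.
Qed.

(* A projective cover of [M] splits as soon as its kernel is in [perp X]. *)
Lemma core_projective :
  (forall K P M (k : mor K P) (p : mor P M), short_exact k p ->
    projective C P -> (X `&` perp X) M -> perp X K) ->
  X `&` perp X = projective C.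
Proof.
move=> kerE; apply/seteqP; split; last exact: projective_sub_core.
move=> M wM; have [K [P [k [p [Pp kp]]]]] := projective_cover enoughP M.
have YK := kerE _ _ _ _ _ kp Pp wM.
have [s ps] := ext1_lift enoughP (idc M) (cotorsion_orth enoughP cotX (proj1 wM) YK) kp.
exact: projective_retract ps Pp.
Qed.

Lemma epikernels_core_projective :
  closed_epikernels (perp X) -> X `&` perp X = projective C.
Proof.
move=> epik; apply: core_projective => K P M k p kp /projective_sub_core [_ YP] [_ YM].
exact: epik kp YP YM.
Qed.

Lemma fin_res_epikernels_core_projective :
  closed_epikernels (fin_res (X `&` perp X) m) -> X `&` perp X = projective C.
Proof.
move=> epik; apply: core_projective => K P M k p kp Pp wM.
apply: (fin_res_sub_perp enoughP cotX herX (n := m)).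
by apply: epik kp _ _; apply: core_sub_fin_res => //; apply: projective_sub_core.
Qed.

Lemma fin_res_hereditary : closed_epikernels (fin_res (X `&` perp X) m) ->
  hereditary_pair (fin_res (X `&` perp X) m) (perp_ 1 (fin_res (X `&` perp X) m)).
Proof.
move=> epik; apply: closed_syzygies_hereditary => //.
  by move=> M N; apply: (cotorsion_orth enoughP (proj1 ctpw)).
by move=> P /projective_sub_core /core_sub_fin_res.
Qed.

End CompletePair.

(* A map from [X0] in [X] to [D] in [perp X] extends to a special preenvelope of
   [X0], which is projective, and then lifts along [B -> D]. *)
Lemma core_projective_epikernels :
  X `&` perp X = projective C -> closed_epikernels (perp X).
Proof.
move=> wP A B D i p ip YB YD; apply/(cotorsion_r enoughP cotX) => X0 XX0 K P k q Pp kq f.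
have [_ [X1 [Y0 [j [c [jc XX1 YY0]]]]]] := proj2 ctpX X0.
have Y0p : projective C Y0.
  by rewrite -wP; split=> //; apply: (cotorsion_l_extensions enoughP cotX) jc XX0 XX1.
have lift (h : mor X0 D) : exists g, p ∘ g = h.
  have [h' h'j] := ext1_extend enoughP h (cotorsion_orth enoughP cotX XX1 YD) jc.
  have [g pg] := Y0p _ _ p h' (ses_epi ip).
  by exists (g ∘ j); rewrite compcA pg.
(* [g : P -> B] extends [i ∘ f] and induces [h : X0 -> D]. Subtracting from [g] a lift of [h] to [B]
   leaves a map into [A], unchanged on [K]. *)
have [g gk] := ext1_extend enoughP (i ∘ f) (cotorsion_orth enoughP cotX XX0 YB) kq.
have [|h hq] := ses_desc (g := p ∘ g) kq.
  by rewrite -compcA gk compcA (ses_comp0 ip) comp0c.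
have [l pl] := lift h.
have [|a ia] := ses_lift (g := g - l ∘ q) ip.
  by rewrite compcB compcA pl hq subrr.
exists a; apply: (ses_mono ip).
by rewrite compcA ia compBc gk -compcA (ses_comp0 kq) compc0 subr0.
Qed.

Lemma core_projective_fin_res_epikernels :
  X `&` perp X = projective C -> closed_epikernels (fin_res (X `&` perp X) m).
Proof.
move=> ->; exact: (fin_res_epikernels enoughP (projective_cotorsion_pair enoughP)
  (projective_hereditary_pair enoughP)).
Qed.

Lemma fin_res_cap_perp :
  fin_res X m `&` perp X = fin_res (X `&` perp X) m.
Proof.
apply/seteqP; split; first exact: (fin_res_perp enoughP cotX herX) (proj2 ctpX).
move=> M resM; split; last exact: (fin_res_sub_perp enoughP cotX herX) resM.
by apply: fin_res_sub resM => ? [].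
Qed.

(** * The two cotorsion pairs of the Hovey triple *)

Section HoveyTriple.
Hypothesis ctpw : complete_cotorsion_pair (fin_res (X `&` perp X) m)
              (perp_ 1 (fin_res (X `&` perp X) m)).
Hypothesis wP : X `&` perp X = projective C.

Let F := fin_res (projective C) m.
Let Q := fin_res X m.
Let Y := perp X.
Let R := perp F.

Lemma cap_perp_fin_res_projective : Q `&` Y = F.
Proof. by rewrite /Q /Y fin_res_cap_perp wP. Qed.

(** This is [ctpw] rewritten by [wP]; heredity identifies [perp_ 1 F] with [perp F]. *)
Lemma complete_fin_res_projective : complete_cotorsion_pair F R /\ hereditary_pair F R.
Proof.
have epik := core_projective_fin_res_epikernels wP.
have her := fin_res_hereditary ctpw epik.
have [cotF _] := ctpw; rewrite wP in cotF her.
have RE : R = perp_ 1 F by apply: (hereditary_perp enoughP cotF her).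
by rewrite RE /F -wP; split=> //; rewrite wP.
Qed.

Let cotF : cotorsion_pair F R := proj1 (proj1 complete_fin_res_projective).

Lemma sub_dim_X : X `<=` Q.
Proof. by apply: sub_fin_res; apply: (zero_cotorsion_l enoughP cotX). Qed.

Lemma sub_dim_F : F `<=` Q.
Proof. by rewrite -cap_perp_fin_res_projective => ? []. Qed.

Lemma sub_perp_F : F `<=` Y.
Proof. by rewrite -cap_perp_fin_res_projective => ? []. Qed.

Let Qext : closed_extensions Q := fin_res_extensions enoughP cotX herX (n := m).

(* [M] embeds into some [D] in [F] with cokernel in [X]. *)
Lemma dim_orth M N : Q M -> (Y `&` R) N -> extn 0 M N.
Proof.
move=> QM [YN RN]; have [_ [A [D [i [p [ip XA YD]]]]]] := proj2 ctpX M.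
apply: (extn_epikernel enoughP ip).
  apply: (cotorsion_orth enoughP cotF) => //.
  rewrite -cap_perp_fin_res_projective; split=> //.
  exact: Qext ip QM (sub_dim_X XA).
by apply: (proj1 (hereditary_pairP enoughP _ _) herX).
Qed.

(** A preenvelope [D] of [M] for [(X, Y)] is followed by one of [D] for [(F, R)]. The total cokernel
    is an extension of an object of [F] by one of [X], and [D'] stays in [Y] because [F] lies in
    [Y]. *)
Lemma dim_preenvelope M :
  exists A D (i : mor M D) (p : mor D A), [/\ short_exact i p, Q A & (Y `&` R) D].
Proof.
have [_ [A [D [i [p [ip XA YD]]]]]] := proj2 ctpX M.
have [_ [A' [D' [i' [p' [ip' FA RD']]]]]] := proj2 (proj1 complete_fin_res_projective) D.
have [B [c [u [v [ic uv]]]]] := mono_comp_ses enoughP ip ip'.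
exists B, D', (i' ∘ i), c; split=> //.
  exact: Qext uv (sub_dim_X XA) (sub_dim_F FA).
by split=> //; apply: (cotorsion_r_extensions enoughP cotX) ip' YD (sub_perp_F FA).
Qed.

(* Salce's trick: push out a projective cover of [M] along a preenvelope of its kernel. *)
Lemma dim_precover M :
  exists A D (i : mor D A) (p : mor A M), [/\ short_exact i p, Q A & (Y `&` R) D].
Proof.
have [K [P [k [p [Pp kp]]]]] := projective_cover enoughP M.
have [A [D [i [q [iq QA YRD]]]]] := dim_preenvelope K.
have [E [j [r [g [jr _ kk]]]]] := pushout_ses enoughP kp (ses_mono iq).
have [q' gq'] := kk _ _ iq; exists E, D, j, r; split=> //.
apply: Qext gq' _ QA; apply: sub_dim_X.
exact: (projective_cotorsion_l enoughP cotX).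
Qed.

(** The right class is determined by the subclasses [X] and [F] of [Q]. An object left orthogonal to
    it splits off its special precover, and [Q] is closed under retracts. *)
Lemma dim_cotorsion_pair : cotorsion_pair Q (Y `&` R).
Proof.
apply/(cotorsion_pairP enoughP); split=> M.
  split=> [YRM N QN|orth]; first exact: dim_orth.
  split; first by apply/(cotorsion_r enoughP cotX) => N /sub_dim_X /orth.
  by apply/(cotorsion_r enoughP cotF) => N /sub_dim_F /orth.
split=> [QM N YRN|orth]; first exact: dim_orth.
have [A [D [i [p [ip QA YRD]]]]] := dim_precover M.
have [s ps] := ext1_lift enoughP (idc M) (orth _ YRD) ip.
exact: (fin_res_retract enoughP cotX herX ps QA).
Qed.

Lemma dim_hereditary_Hovey_triple : hereditary_Hovey_triple Q Y R.
Proof.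
have [ctpF herF] := complete_fin_res_projective.
split; rewrite ?cap_perp_fin_res_projective //.
  split; rewrite ?cap_perp_fin_res_projective //.
    exact/perp_thick/core_projective_epikernels.
  split; first exact: dim_cotorsion_pair.
  by move=> M; split; [exact: dim_precover|exact: dim_preenvelope].
apply: closed_syzygies_hereditary => // [M N||P Pp]; first exact: dim_orth.
  exact: (fin_res_epikernels enoughP cotX herX).
by apply: sub_dim_X; apply: (projective_cotorsion_l enoughP cotX).
Qed.

End HoveyTriple.
End FrobeniusCotorsion.

(** * Localizations *)

Section Categories.
Implicit Types C D H : category.

Lemma iso_comp C (X Y Z : C) (g : mor Y Z) (f : mor X Y) :
  is_iso g -> is_iso f -> is_iso (g ∘ f).
Proof.
move=> [g' [g'g gg']] [f' [f'f ff']]; exists (f' ∘ g').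
by rewrite -!compcA (compcA g') (compcA f) g'g ff' !compc1l.
Qed.

Lemma fmap_iso C D (F : functor C D) (X Y : C) (f : mor X Y) :
  is_iso f -> is_iso (fmap F f).
Proof. by move=> [g [gf fg]]; exists (fmap F g); rewrite -!fmapc gf fg !fmap1. Qed.

Lemma natural_inverse C D (F G : functor C D) (a : forall X, mor (F X) (G X))
    (b : forall X, mor (G X) (F X)) :
  natural a -> (forall X, b X ∘ a X = idc (F X)) -> (forall X, a X ∘ b X = idc (G X)) ->
  natural b.
Proof.
move=> an ba ab X Y f; rewrite -[LHS]compc1r -(ab X) compcA -(compcA _ (fmap G f)) -an.
by rewrite !compcA ba compc1l.
Qed.

(* The isomorphism [G L -> L] extends uniquely along [L], and so does its inverse;
   uniqueness makes the extensions mutually inverse. *)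
Lemma localization_comparison C H (W : morclass C) (L : functor C H)
    (G : functor H H) :
  is_localization W L -> naturally_isomorphic (functor_comp G L) L ->
  naturally_isomorphic G (functor_id H).
Proof.
move=> [_ _ ff] [a [an ai]]; pose a' X := sval (cid (ai X)).
have a'P X : a' X ∘ a X = idc _ /\ a X ∘ a' X = idc _ := svalP (cid (ai X)).
have a'n : natural (F := L) (G := functor_comp G L) a'.
  by apply: natural_inverse an _ _ => X; case: (a'P X).
have [b [[bn ba] _]] := ff H G (functor_id H) a an.
have [b' [[b'n b'a] _]] := ff H (functor_id H) G a' a'n.
have idn (K : functor H H) : natural (F := K) (G := K) (fun Y => idc (K Y)).
  by move=> Y Z f; rewrite compc1l compc1r.
have [e [_ eU]] := ff H G G (fun X => idc _) (fun X Y f => idn G _ _ (fmap L f)).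
have [e' [_ e'U]] := ff H (functor_id H) (functor_id H) (fun X => idc _)
  (fun X Y f => idn (functor_id H) _ _ (fmap L f)).
exists b; split=> // Y; exists (b' Y); split.
  suff E : (fun Y => b' Y ∘ b Y) = (fun Y => idc (G Y)) by exact: (congr1 (@^~ Y) E).
  rewrite -(eU (fun Y => idc _)); last by split; [exact: idn|].
  apply/esym/eU; split=> [Z T f|X]; last by rewrite ba b'a; case: (a'P X).
  by rewrite -compcA bn compcA b'n compcA.
suff E : (fun Y => b Y ∘ b' Y) = (fun Y => idc (functor_id H Y)) by exact: (congr1 (@^~ Y) E).
rewrite -(e'U (fun Y => idc _)); last by split; [exact: idn|].
apply/esym/e'U; split=> [Z T f|X]; last by rewrite ba b'a; case: (a'P X).
by rewrite -compcA b'n compcA bn compcA.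
Qed.

Lemma localization_round_trip C H H' (L : functor C H) (L' : functor C H')
    (G : functor H' H) (G' : functor H H') :
  naturally_isomorphic (functor_comp G L') L ->
  naturally_isomorphic (functor_comp G' L) L' ->
  naturally_isomorphic (functor_comp (functor_comp G' G) L') L'.
Proof.
move=> [a [an ai]] [b [bn bi]]; exists (fun X => b X ∘ fmap G' (a X)); split=> [X Y f|X].
  by rewrite /= -compcA -fmapc an fmapc compcA bn compcA.
exact: iso_comp (bi X) (fmap_iso G' (ai X)).
Qed.

(** Each universal property gives a functor to the other category. Both round trips preserve the
    localization functor up to isomorphism, so they are isomorphic to identities. *)
Lemma localization_unique C H H' (W : morclass C) (L : functor C H) (L' : functor C H') :
  is_localization W L -> is_localization W L' -> equivalent_categories H H'.
Proof.
move=> locL locL'.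
have [G' G'L] := loc_factor locL (loc_inverts locL').
have [G GL'] := loc_factor locL' (loc_inverts locL).
exists G', G; split.
  by apply: localization_comparison locL _; apply: localization_round_trip G'L GL'.
by apply: localization_comparison locL' _; apply: localization_round_trip GL' G'L.
Qed.

Lemma quot_comp_pi C (R : forall X Y : C, mor X Y -> mor X Y -> Prop)
    (congR : is_congruence R) (X Y Z : C) (g : mor Y Z) (f : mor X Y) :
  quot_comp (quot_pi congR g) (quot_pi congR f) = quot_pi congR (g ∘ f).
Proof. by apply/quot_piP; apply: (cong_comp congR); apply: quot_repr_pi. Qed.

End Categories.

(** * The ideal of maps factoring through a class of objects *)

Section FactorsThrough.
Variables (C : abelian) (XX : set C).

Lemma factors_compl X Y Z (g : mor Y Z) (f : mor X Y) :
  factors_through XX f -> factors_through XX (g ∘ f).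
Proof. by move=> [V [a [b [XV ->]]]]; exists V, a, (g ∘ b); rewrite compcA. Qed.

Lemma factors_compr X Y Z (g : mor Y Z) (f : mor X Y) :
  factors_through XX g -> factors_through XX (g ∘ f).
Proof. by move=> [V [a [b [XV ->]]]]; exists V, (a ∘ f), b; rewrite compcA. Qed.

Lemma factors_opp X Y (f : mor X Y) : factors_through XX f -> factors_through XX (- f).
Proof. by move=> [V [a [b [XV ->]]]]; exists V, (- a), b; rewrite compcN. Qed.

Hypothesis XX0 : zero_object C `<=` XX.

Lemma factors0 X Y : factors_through XX (0 : mor X Y).
Proof.
by have [Z Z0] := ab_zero (abP C); exists Z, 0, 0; rewrite compc0; split=> //; apply: XX0.
Qed.

Hypothesis XXext : closed_extensions XX.

(** The sum passes through the biproduct of the two middle objects, an extension of one by the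
    other. *)
Lemma factors_add X Y (f g : mor X Y) :
  factors_through XX f -> factors_through XX g -> factors_through XX (f + g).
Proof.
move=> [A [a [b [XA ->]]]] [B [a' [b' [XB ->]]]].
have [S [i1 [i2 [p1 [p2 bip]]]]] := ab_biproduct (abP C) A B.
exists S, (i1 ∘ a + i2 ∘ a'), (b ∘ p1 + b' ∘ p2); split.
  exact: XXext (biproduct_ses bip) XA XB.
case: bip => p1i1 p2i2 p2i1 p1i2 _.
rewrite compcDl !compcDr -!compcA !(compcA p1) !(compcA p2) p1i1 p1i2 p2i1 p2i2.
by rewrite !comp0c !compc0 !compc1l addr0 add0r.
Qed.

Lemma stably_equal_congruence (BB : set C) : is_congruence (stably_equal BB XX).
Proof.
split=> [X Y f|X Y f g|X Y f g h|X Y Z f f' g g'] /=; rewrite /stably_equal /=.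
- by rewrite subrr; apply: factors0.
- by move/factors_opp; rewrite opprB.
- by move=> fg gh; rewrite -(subrKA g); apply: factors_add.
- move=> ff' gg'; rewrite -(subrKA (g' ∘ f)) -compBc -compcB.
  by apply: factors_add; [apply: factors_compr|apply: factors_compl].
Qed.

End FactorsThrough.

(** * The homotopy category of a hereditary Hovey triple *)

Section HomotopyCategory.
Variables (C : abelian) (Q W R : set C).
Hypothesis enoughP : enough_projectives C.
Hypothesis hov : hereditary_Hovey_triple Q W R.
Implicit Types A B D K M N X Y Z : C.

Let cotQ : cotorsion_pair Q (W `&` R). Proof. by case: hov => -[_ _ []]. Qed.
Let cotR : cotorsion_pair (Q `&` W) R. Proof. by case: hov => -[_ []]. Qed.
Let complQ : complete_pair Q (W `&` R). Proof. by case: hov => -[_ _ []]. Qed.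
Let complR : complete_pair (Q `&` W) R. Proof. by case: hov => -[_ []]. Qed.
Let herQ : hereditary_pair Q (W `&` R). Proof. by case: hov. Qed.
Let Wext : closed_extensions W. Proof. by case: hov => -[[]]. Qed.
Let Qext : closed_extensions Q := cotorsion_l_extensions enoughP cotQ.
Let Rext : closed_extensions R := cotorsion_r_extensions enoughP cotR.

Let zeroQW : zero_object C `<=` Q `&` W := zero_cotorsion_l enoughP cotR.
Let zeroWR : zero_object C `<=` W `&` R := zero_cotorsion_r enoughP cotQ.
Let zeroW : zero_object C `<=` W. Proof. by move=> Z /zeroQW []. Qed.

Let T : set C := Q `&` W `&` R.

Let Text : closed_extensions T.
Proof.
move=> A B D i p ip [[QA WA] RA] [[QD WD] RD].
by split; [split; [exact: Qext ip QA QD|exact: Wext ip WA WD]|exact: Rext ip RA RD].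
Qed.

Let zeroT : zero_object C `<=` T.
Proof. by move=> Z Z0; split; [exact: zeroQW|case: (zeroWR Z0)]. Qed.

Lemma cofibrant_lift K B D A (i : mor K B) (p : mor B D) (f : mor A D) :
  short_exact i p -> Q A -> (W `&` R) K -> exists g, p ∘ g = f.
Proof. by move=> ip QA WRK; apply: ext1_lift ip => //; apply: (cotorsion_orth enoughP cotQ). Qed.

Lemma fibrant_extend A B D Y (i : mor A B) (p : mor B D) (f : mor A Y) :
  short_exact i p -> (Q `&` W) D -> R Y -> exists g, g ∘ i = f.
Proof. by move=> ip QWD RY; apply: ext1_extend ip => //; apply: (cotorsion_orth enoughP cotR). Qed.

(** * Null maps: those factoring through a trivial object *)

Local Notation null := (factors_through W).

Let null0 X Y : null (0 : mor X Y) := factors0 zeroW X Y.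

Lemma null_ses A B D X (i : mor A B) (p : mor B D) (f : mor X B) :
  short_exact i p -> p ∘ f = 0 -> W A -> null f.
Proof. by move=> ip /(ses_lift ip) [h <-] WA; exists A, h, i. Qed.

(** Replacing the trivial object [V] by a cofibrant one makes both halves of the factorization
    liftable. The lifted composite differs from [h] by a map through [K], itself trivial. *)
Lemma null_lift K B D A (i : mor K B) (p : mor B D) (h : mor A B) :
  short_exact i p -> Q A -> (W `&` R) K -> null (p ∘ h) -> null h.
Proof.
move=> ip QA WRK [V [a [b [WV phE]]]].
have [V' [K' [k [v [kv QV' [WK' RK']]]]]] := proj1 (complQ V).
have [a' va'] := cofibrant_lift a kv QA (conj WK' RK').
have [b' pb'] := cofibrant_lift (b ∘ v) ip QV' WRK.
rewrite -(subrK (b' ∘ a') h); apply: (factors_add Wext); last first.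
  by exists V', a', b'; split=> //; apply: Wext kv WK' WV.
have [|g <-] := ses_lift (g := h - b' ∘ a') ip.
  by rewrite compcB phE compcA pb' -compcA va' subrr.
by exists K, g, i; split=> //; case: WRK.
Qed.

(** Dual to [null_lift], with a fibrant replacement of [V]. *)
Lemma null_extend A B D Y (i : mor A B) (p : mor B D) (g : mor B Y) :
  short_exact i p -> (Q `&` W) D -> R Y -> null (g ∘ i) -> null g.
Proof.
move=> ip QWD RY [V [a [b [WV giE]]]].
have [F [V' [v [c [vc [QF WF] RV']]]]] := proj2 (complR V).
have [a' a'i] := fibrant_extend (v ∘ a) ip QWD RV'.
have [b' b'v] := fibrant_extend b vc (conj QF WF) RY.
rewrite -(subrK (b' ∘ a') g); apply: (factors_add Wext); last first.
  by exists V', a', b'; split=> //; apply: Wext vc WV WF.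
have [|h <-] := ses_desc (g := g - b' ∘ a') ip.
  by rewrite compBc giE -compcA a'i compcA b'v subrr.
by exists D, p, h; split=> //; case: QWD.
Qed.

(** The middle object is made first cofibrant, then fibrant; it stays trivial because [W] is closed
    under extensions. *)
Lemma null_bifibrant X Y (f : mor X Y) : Q X -> R Y -> null f -> factors_through T f.
Proof.
move=> QX RY [V [a [b [WV ->]]]].
have [V' [K [k [v [kv QV' [WK RK]]]]]] := proj1 (complQ V).
have [F [V'' [v' [c [vc [QF WF] RV'']]]]] := proj2 (complR V').
have [a' <-] := cofibrant_lift a kv QX (conj WK RK).
have [b' b'E] := fibrant_extend (b ∘ v) vc (conj QF WF) RY.
exists V'', (v' ∘ a'), b'; split; last by rewrite !compcA b'E.
split=> //; split; first exact: Qext vc QV' QF.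
exact: Wext vc (Wext kv WK WV) WF.
Qed.

(* A cofibrant replacement [M <- cof] followed by a fibrant one [cof -> bif]. *)
Record replacement M := Replacement {
  bif : C; cof : C; repk : C; repc : C;
  rk : mor repk cof; rq : mor cof M; rj : mor cof bif; rc : mor bif repc;
  rkq : short_exact rk rq; rjc : short_exact rj rc;
  cofQ : Q cof; bifQR : (Q `&` R) bif;
  repkWR : (W `&` R) repk; repcQW : (Q `&` W) repc }.

Lemma replacement_ex M : inhabited (replacement M).
Proof.
have [A [K [k [q [kq QA WRK]]]]] := proj1 (complQ M).
have [F [B [j [c [jc QWF RB]]]]] := proj2 (complR A).
split; apply: (Replacement kq jc) => //; split=> //.
by apply: Qext jc QA _; case: QWF.
Qed.

Let rep M : replacement M := inhabited_witness (replacement_ex M).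
Local Notation q M := (rq (rep M)).
Local Notation j M := (rj (rep M)).
Local Notation cofr M := (cof (rep M)).
Local Notation bifr M := (bif (rep M)).

(* [g : bifr M -> bifr N] is what [f] induces on bifibrant replacements. *)
Definition represents M N (f : mor M N) (g : mor (bifr M) (bifr N)) : Prop :=
  exists f', q N ∘ f' = f ∘ q M /\ g ∘ j M = j N ∘ f'.

Lemma extend_bif M Y (f : mor (cofr M) Y) : R Y -> exists g, g ∘ j M = f.
Proof. by apply: fibrant_extend (rjc (rep M)) (repcQW (rep M)). Qed.

Lemma lift_cof M A (f : mor A M) : Q A -> exists g, q M ∘ g = f.
Proof. by move=> QA; apply: cofibrant_lift (rkq (rep M)) QA (repkWR (rep M)). Qed.

Lemma bifR M : R (bifr M). Proof. by case: (bifQR (rep M)). Qed.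

Lemma bifQ M : Q (bifr M). Proof. by case: (bifQR (rep M)). Qed.

Lemma represents_ex M N (f : mor M N) : exists g, represents f g.
Proof.
have [f' f'E] := lift_cof (f ∘ q M) (cofQ (rep M)).
have [g gE] := extend_bif (j N ∘ f') (bifR N).
by exists g, f'.
Qed.

(** The common test for homotopies: nullity goes back along [q N], then along [j M], and finally the
    middle object is made bifibrant. *)
Lemma null_replacement M N Y (g : mor (bifr M) Y) (y : mor (cofr N) Y)
    (h : mor (cofr M) (cofr N)) :
  R Y -> g ∘ j M = y ∘ h -> null (q N ∘ h) -> factors_through T g.
Proof.
move=> RY gj qh0; apply: null_bifibrant => //; first exact: bifQ.
apply: (null_extend (rjc (rep M)) (repcQW (rep M)) RY); rewrite gj; apply: factors_compl.
exact: (null_lift (rkq (rep N)) (cofQ (rep M)) (repkWR (rep N))).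
Qed.

Lemma represents_unique M N (f : mor M N) g g' :
  represents f g -> represents f g' -> factors_through T (g - g').
Proof.
move=> [f1 [f1E gE]] [f2 [f2E g'E]].
apply: (@null_replacement _ _ _ _ (j N) (f1 - f2)); first exact: bifR.
  by rewrite compBc gE g'E compcB.
by rewrite compcB f1E f2E subrr.
Qed.

Lemma represents1 M : represents (idc M) (idc (bifr M)).
Proof. by exists (idc _); rewrite !compc1l !compc1r. Qed.

Lemma represents_comp M N D (f : mor M N) (f' : mor N D) g g' :
  represents f g -> represents f' g' -> represents (f' ∘ f) (g' ∘ g).
Proof.
move=> [h [hE gE]] [h' [h'E g'E]]; exists (h' ∘ h); split.
  by rewrite compcA h'E -compcA hE compcA.
by rewrite -compcA gE compcA g'E compcA.
Qed.

Local Notation BB := (full_subcategory (Q `&` R)).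

Lemma stably_equal_bifibrant_congruence : is_congruence (stably_equal (Q `&` R) T).
Proof. exact: stably_equal_congruence zeroT Text _. Qed.

Variable cong : is_congruence (stably_equal (Q `&` R) T).
Local Notation Ho := (quotient_category cong).
Local Notation cl f := (quot_pi cong f).

Definition bif_ob M : Ho := exist (fun X => (Q `&` R) X) (bifr M) (bifQR (rep M)).

Lemma cl_eq (X Y : BB) (f g : mor X Y) :
  cl f = cl g <-> factors_through T ((f : mor (sval X) (sval Y)) - g).
Proof. exact: quot_piP. Qed.

Lemma cl_comp (X Y Z : BB) (g : mor Y Z) (f : mor X Y) :
  (cl g : @mor Ho Y Z) ∘ (cl f : @mor Ho X Y) = cl (g ∘ f).
Proof. exact: quot_comp_pi. Qed.

(** The representing map is chosen; by [represents_unique] its class does not depend on the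
    choice. *)
Definition bif_map M N (f : mor M N) : @mor Ho (bif_ob M) (bif_ob N) :=
  cl (sval (cid (represents_ex f)) : @mor BB (bif_ob M) (bif_ob N)).

Lemma bif_mapE M N (f : mor M N) (g : @mor BB (bif_ob M) (bif_ob N)) :
  represents f g -> bif_map f = cl g.
Proof.
by move=> fg; apply/cl_eq; apply: represents_unique fg; apply: svalP (cid (represents_ex f)).
Qed.

Lemma bif_map1 M : bif_map (idc M) = idc (bif_ob M).
Proof. by rewrite (bif_mapE (represents1 M)). Qed.

Lemma bif_mapc M N D (g : mor N D) (f : mor M N) :
  bif_map (g ∘ f) = bif_map g ∘ bif_map f.
Proof.
have [f' ff'] := represents_ex f; have [g' gg'] := represents_ex g.
rewrite (bif_mapE ff') (bif_mapE gg') cl_comp.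
exact/bif_mapE/represents_comp.
Qed.

Definition bif_functor : functor C Ho :=
  @Functor C Ho bif_ob bif_map bif_map1 bif_mapc.

(** As [cofr N] is cofibrant, [q N] lifts along [p] and then along [q M]. The lift [s'] induces the
    inverse [t] on bifibrant replacements. *)
Lemma bif_trivial_fibration M N (p : mor M N) :
  epi_with_kernel_in (W `&` R) p -> is_iso (fmap bif_functor p).
Proof.
move=> [pe [K [k [/kernel_ses /(_ pe) kp WRK]]]].
have [g [f' [f'E gE]]] := represents_ex p.
have [s ps] := cofibrant_lift (q N) kp (cofQ (rep N)) WRK.
have [s' s'E] := lift_cof s (cofQ (rep N)).
have [t tE] := extend_bif (j M ∘ s') (bifR M).
rewrite /= (bif_mapE (g := g)); last by exists f'.
exists (cl (t : @mor BB (bif_ob N) (bif_ob M))); rewrite !cl_comp; split; apply/cl_eq => /=.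
  apply: (@null_replacement _ _ _ _ (j M) (s' ∘ f' - idc _)); first exact: bifR.
    by rewrite compBc -compcA gE compcA tE compcB -compcA compc1l compc1r.
  apply: (null_ses kp); last by case: WRK.
  by rewrite compcB (compcA _ s') s'E compc1r compcB compcA ps f'E subrr.
apply: (@null_replacement _ _ _ _ (j N) (f' ∘ s' - idc _)); first exact: bifR.
  by rewrite compBc -compcA tE compcA gE compcB -compcA compc1l compc1r.
by rewrite compcB compcA f'E -compcA s'E ps compc1r subrr; apply: null0.
Qed.

Lemma bif_trivial_cofibration M N (i : mor M N) :
  mono_with_cokernel_in (Q `&` W) i -> is_iso (fmap bif_functor i).
Proof.
move=> [im [F [c [/cokernel_ses /(_ im) ic QWF]]]].
have [g [i' [i'E gE]]] := represents_ex i.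
(* [E], the preimage of [M] in [cofr N], is another cofibrant replacement of [M]. *)
have [E [ε [u0 [e [εc u0e ie ε0]]]]] := epi_comp_ses enoughP (rkq (rep N)) ic.
have QE : Q E.
  apply: (hereditary_epikernels enoughP cotQ herQ) εc (cofQ _) _.
  by case: QWF.
have [u uE] := lift_cof e QE.
(* [u] compares [E] with [cofr M]. Extending [j M ∘ u] along [ε] and then along [j N] gives the
   inverse [t']. *)
have [t tE] := fibrant_extend (j M ∘ u) εc QWF (bifR M).
have [t' t'E] := extend_bif t (bifR M).
have [|v vE] := ses_lift (g := i') εc.
  by rewrite -compcA i'E compcA (ses_comp0 ic) comp0c.
have ev : e ∘ v = q M.
  by apply: (ses_mono ic); rewrite compcA ie -compcA vE.
rewrite /= (bif_mapE (g := g)); last by exists i'.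
exists (cl (t' : @mor BB (bif_ob N) (bif_ob M))); rewrite !cl_comp; split; apply/cl_eq => /=.
  apply: (@null_replacement _ _ _ _ (j M) (u ∘ v - idc _)); first exact: bifR.
    rewrite compBc -compcA gE compcA t'E -vE compcA tE.
    by rewrite compcB -compcA compc1l compc1r.
  by rewrite compcB compcA uE ev compc1r subrr; apply: null0.
(* Nullity is tested after restriction along both trivial cofibrations [j N] and [ε], because [t']
   is only known on [E]. *)
apply: null_bifibrant; [exact: bifQ|exact: bifR|].
apply: (null_extend (rjc (rep N)) (repcQW (rep N)) (bifR N)).
apply: (null_extend εc QWF (bifR N)).
have -> : (g ∘ t' - idc (bifr N)) ∘ j N ∘ ε = j N ∘ (i' ∘ u - ε).
  rewrite !compBc compc1l -(compcA g) t'E -(compcA g) tE compcA gE.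
  by rewrite compcB compcA.
apply: factors_compl; apply: (null_ses (rkq (rep N))); last by case: (repkWR (rep N)).
by rewrite compcB compcA i'E -compcA uE ie subrr.
Qed.

Lemma bif_weak_equivalence M N (f : mor M N) :
  weak_equivalence Q W R f -> is_iso (fmap bif_functor f).
Proof.
move=> [D [i [p [ti fp ->]]]]; rewrite fmapc.
by apply: iso_comp; [apply: bif_trivial_fibration|apply: bif_trivial_cofibration].
Qed.

(** The identity serves as the trivial cofibration, its cokernel being a zero object. *)
Lemma trivial_fibration_weq M N K (k : mor K M) (p : mor M N) :
  short_exact k p -> (W `&` R) K -> weak_equivalence Q W R p.
Proof.
move=> kp WRK; have [Z [z [Z0 iz]]] := ses_idl M.
exists M, (idc M), p; rewrite compc1r; split=> //.
  split; first exact: ses_mono iz.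
  by exists Z, z; split; [case: iz|apply: zeroQW].
by split; [apply: ses_epi kp|exists K, k; split=> //; case: kp].
Qed.

Lemma trivial_cofibration_weq M N F (i : mor M N) (c : mor N F) :
  short_exact i c -> (Q `&` W) F -> weak_equivalence Q W R i.
Proof.
move=> ic QWF; have [Z [z [Z0 zi]]] := ses_idr N.
exists N, i, (idc N); rewrite compc1l; split=> //.
  by split; [apply: ses_mono ic|exists F, c; split=> //; case: ic].
split; first exact: ses_epi zi.
by exists Z, z; split; [case: zi|apply: zeroWR].
Qed.

(** * Functors inverting the weak equivalences descend to the stable category *)

Section Factorization.
Variables (D : category) (F : functor C D).
Hypothesis Finv : forall M N (f : mor M N), weak_equivalence Q W R f -> is_iso (fmap F f).

(* Homotopic maps are equalized: [(1, 0)] and [(1, a)] are both sections of the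
   projection [X + Z -> X], a trivial fibration. *)
Lemma inverting_stably_equal X Y (f g : mor X Y) :
  factors_through T (f - g) -> fmap F f = fmap F g.
Proof.
move=> [Z [a [b [[[QZ WZ] RZ] fgE]]]].
have [S [i1 [i2 [p1 [p2 bip]]]]] := ab_biproduct (abP C) Z X.
have ses := biproduct_ses bip; case: bip => p1i1 p2i2 p2i1 p1i2 _.
have Fp2 : is_iso (fmap F p2) by apply/Finv/(trivial_fibration_weq ses).
have F12 : fmap F (i2 + i1 ∘ a) = fmap F i2.
  apply: (iso_mono Fp2); rewrite -!fmapc; congr (fmap F _).
  by rewrite compcDr compcA p2i1 comp0c addr0.
have -> : f = (g ∘ p2 + b ∘ p1) ∘ (i2 + i1 ∘ a).
  rewrite compcDl !compcDr -!compcA !(compcA p1) !(compcA p2) p1i1 p1i2 p2i1 p2i2.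
  by rewrite !comp0c !compc0 !compc1l compc1r addr0 add0r -fgE addrC subrK.
rewrite fmapc F12 -fmapc; congr (fmap F _).
by rewrite compcDl -!compcA p1i2 p2i2 compc0 compc1r addr0.
Qed.

Definition descend_map (X Y : Ho) (f : @mor Ho X Y) : mor (F (sval X)) (F (sval Y)) :=
  fmap F (quot_repr f : @mor BB X Y).

Lemma descend_map_cl (X Y : BB) (f : mor X Y) :
  @descend_map X Y (cl f) = fmap F (f : @mor C (sval X) (sval Y)).
Proof. exact/inverting_stably_equal/(quot_repr_pi cong f). Qed.

Lemma descend_map1 (X : Ho) : descend_map (idc X) = idc (F (sval X)).
Proof. by rewrite descend_map_cl fmap1. Qed.

Lemma descend_mapc (X Y Z : Ho) (g : mor Y Z) (f : mor X Y) :
  descend_map (g ∘ f) = descend_map g ∘ descend_map f.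
Proof. by rewrite [LHS]descend_map_cl fmapc. Qed.

Definition descend_functor : functor Ho D :=
  @Functor Ho D (fun X : Ho => F (sval X)) descend_map descend_map1 descend_mapc.

(** The isomorphism at [M] is [fmap F (q M)] after the inverse of [fmap F (j M)]. *)
Lemma descend_functorP :
  naturally_isomorphic (functor_comp descend_functor bif_functor) F.
Proof.
have Fq M : is_iso (fmap F (q M)).
  exact/Finv/(trivial_fibration_weq (rkq (rep M)) (repkWR (rep M))).
have Fj M : is_iso (fmap F (j M)).
  exact/Finv/(trivial_cofibration_weq (rjc (rep M)) (repcQW (rep M))).
pose i M := sval (cid (Fj M)).
have iP M : i M ∘ fmap F (j M) = idc _ /\ fmap F (j M) ∘ i M = idc _ := svalP (cid (Fj M)).
exists (fun M => fmap F (q M) ∘ i M); split=> [M N f|M]; last first.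
  by apply: iso_comp => //; exists (fmap F (j M)); case: (iP M).
have [g fg] := represents_ex f; have [f' [f'E gE]] := fg.
rewrite /= (bif_mapE fg) descend_map_cl; apply: (iso_epi (Fj M)).
rewrite -!compcA (proj1 (iP M)) compc1r -[fmap F g ∘ _]fmapc gE fmapc.
by rewrite (compcA (i N)) (proj1 (iP N)) compc1l -!fmapc f'E.
Qed.

End Factorization.

(** * Bifibrant objects compared with their own replacements *)

Lemma bifrep_ex (X : BB) : exists s : mor (sval X) (cofr (sval X)), q (sval X) ∘ s = idc (sval X).
Proof. by apply: lift_cof; case: X => X []. Qed.

Definition bifrep_section (X : BB) := sval (cid (bifrep_ex X)).

Lemma bifrep_sectionE (X : BB) : q (sval X) ∘ bifrep_section X = idc (sval X).
Proof. exact: svalP (cid (bifrep_ex X)). Qed.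

Definition bifrep (X : Ho) : @mor Ho X (bif_ob (sval X)) :=
  cl (j (sval X) ∘ bifrep_section X : @mor BB X (bif_ob (sval X))).

Lemma bifrep_natural (X Y : BB) (f : mor X Y) :
  bifrep Y ∘ (cl f : @mor Ho X Y) = fmap bif_functor (f : @mor C (sval X) (sval Y)) ∘ bifrep X.
Proof.
have [g fg] := represents_ex (f : @mor C (sval X) (sval Y)).
rewrite [fmap _ _](bif_mapE fg) !cl_comp; apply/cl_eq => /=.
have [f' [f'E gE]] := fg.
have [QX RX] := svalP X.
apply: null_bifibrant => //; first exact: bifR.
rewrite (compcA g) gE -!compcA -compcB; apply: factors_compl.
apply: (null_ses (rkq (rep (sval Y)))); last by case: (repkWR (rep (sval Y))).
by rewrite compcB !compcA bifrep_sectionE f'E -compcA bifrep_sectionE compc1l compc1r subrr.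
Qed.

(** Fibrancy of [X] lets [q] extend along [j]; the extension is the inverse. *)
Lemma bifrep_iso (X : Ho) : is_iso (bifrep X).
Proof.
have [QX RX] := svalP X.
have [r rE] := extend_bif (q (sval X)) RX.
exists (cl (r : @mor BB (bif_ob (sval X)) X)); rewrite !cl_comp; split; apply/cl_eq => /=.
  by rewrite compcA rE bifrep_sectionE subrr; apply: factors0.
apply: (@null_replacement _ _ _ _ (j (sval X)) (bifrep_section X ∘ q (sval X) - idc _)).
- exact: bifR.
- by rewrite compBc compc1l -(compcA _ r) rE compcB compc1r compcA.
by rewrite compcB compcA bifrep_sectionE compc1l compc1r subrr; apply: null0.
Qed.

(* The two identifications of [bif_ob M] with [bif_ob (bif_ob M)] agree. *)
Lemma bifrep_bif M :
  bifrep (bif_ob M) ∘ fmap bif_functor (q M) = fmap bif_functor (j M).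
Proof.
have [g qg] := represents_ex (q M); have [h jh] := represents_ex (j M).
rewrite [X in _ ∘ X](bif_mapE qg) [RHS](bif_mapE jh) cl_comp; apply/cl_eq => /=.
have [q' [q'E gE]] := qg; have [j' [j'E hE]] := jh.
pose s := bifrep_section (bif_ob M).
apply: (@null_replacement _ _ _ _ (j (bifr M)) (s ∘ j M ∘ q' - j')); first exact: bifR.
  by rewrite compBc hE -!compcA gE compcB !compcA.
rewrite compcB !compcA (bifrep_sectionE (bif_ob M)) compc1l j'E -compcB.
apply: factors_compl; apply: (null_ses (rkq (rep M))); last by case: (repkWR (rep M)).
by rewrite compcB q'E subrr.
Qed.

(** * Unique extension of natural transformations along [bif_functor] *)

Section FullyFaithful.
Variables (D : category) (G G' : functor Ho D).
Variable a : forall M : C, mor (G (bif_functor M)) (G' (bif_functor M)).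
Hypothesis an : @natural _ _ (functor_comp G bif_functor) (functor_comp G' bif_functor) a.

(** Each [Y] is isomorphic through [bifrep Y] to an object in the image of [bif_functor], so
    naturality forces [b] to be the conjugate of [a]. *)
Lemma natural_extension :
  exists! b : forall Y : Ho, mor (G Y) (G' Y),
    natural b /\ forall M : C, b (bif_functor M) = a M.
Proof.
pose i (Y : Ho) := sval (cid (fmap_iso G' (bifrep_iso Y))).
have iP (Y : Ho) : i Y ∘ fmap G' (bifrep Y) = idc _ /\ fmap G' (bifrep Y) ∘ i Y = idc _ :=
  svalP (cid (fmap_iso G' (bifrep_iso Y))).
have G'mono (Y : Ho) := iso_mono (fmap_iso G' (bifrep_iso Y)).
pose b (Y : Ho) : mor (G Y) (G' Y) := i Y ∘ a (sval Y) ∘ fmap G (bifrep Y).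
have bE (Y : Ho) : fmap G' (bifrep Y) ∘ b Y = a (sval Y) ∘ fmap G (bifrep Y).
  by rewrite !compcA (proj2 (iP Y)) compc1l.
exists b; split; first split=> [X Y f|M].
- apply: G'mono; rewrite -(quot_reprK f).
  set f0 := quot_repr f.
  rewrite compcA bE -compcA -fmapc bifrep_natural fmapc compcA.
  have /= -> := an (f0 : @mor C (sval X) (sval Y)).
  by rewrite compcA -fmapc bifrep_natural fmapc -!compcA bE.
(* [b] at [bif_functor M] involves [a] at [bifr M], not at [M]. Naturality of [a] at [q M] and [j M]
   relates both to [a] at [cofr M], and [bifrep_bif] matches the identifications. *)
- apply: G'mono; rewrite bE.
  have Lq : is_iso (fmap bif_functor (q M)).
    exact/bif_weak_equivalence/(trivial_fibration_weq (rkq (rep M)) (repkWR (rep M))).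
  have qn : a M ∘ fmap G (fmap bif_functor (q M)) =
    fmap G' (fmap bif_functor (q M)) ∘ a (cofr M) := an (q M).
  have jn : a (bifr M) ∘ fmap G (fmap bif_functor (j M)) =
    fmap G' (fmap bif_functor (j M)) ∘ a (cofr M) := an (j M).
  apply: (iso_epi (fmap_iso G Lq)).
  rewrite -[LHS]compcA -fmapc bifrep_bif jn -[RHS]compcA qn.
  by rewrite [RHS]compcA -fmapc bifrep_bif.
- move=> b' [b'n b'E]; apply/functional_extensionality_dep => Y; apply: G'mono; rewrite bE.
  by rewrite -b'n b'E.
Qed.

End FullyFaithful.

Lemma bif_localization : is_localization (weak_equivalence Q W R) bif_functor.
Proof.
split; first exact: bif_weak_equivalence.
  by move=> D F Finv; exists (descend_functor Finv); apply: descend_functorP.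
by move=> D G G' a; apply: natural_extension.
Qed.

End HomotopyCategory.

Lemma Hovey_homotopy_category (C : abelian) (Q W R : set C) :
  enough_projectives C -> hereditary_Hovey_triple Q W R ->
  exists cong : is_congruence (stably_equal (Q `&` R) (Q `&` W `&` R)),
    (exists Ho : category, is_homotopy_category Q W R Ho) /\
    forall Ho : category, is_homotopy_category Q W R Ho ->
      equivalent_categories Ho (quotient_category cong).
Proof.
move=> enoughP hov; have cong := stably_equal_bifibrant_congruence enoughP hov.
have loc := bif_localization enoughP hov cong.
exists cong; split=> [|Ho [L locL]].
  by exists (quotient_category cong), (bif_functor enoughP hov cong).
exact: localization_unique locL loc.
Qed.

Theorem theorem4p1 (C : abelian) (X : set C) (m : nat)
    (enoughP : enough_projectives C)
    (ctpX : complete_cotorsion_pair X (perp X))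
    (herX : hereditary_pair X (perp X))
    (ctpw : complete_cotorsion_pair (fin_res (X `&` perp X) m)
              (perp_ 1 (fin_res (X `&` perp X) m))) :
  let w := X `&` perp X in
  let P := projective C in
  let Q := fin_res X m in
  let W := perp X in
  let R := perp (fin_res P m) in
  let a := closed_epikernels (perp X) in
  let b := closed_epikernels (fin_res w m) in
  let c := w = P in
  [/\ (a <-> b) /\ (b <-> c),
      a -> thick (perp X),
      b -> hereditary_pair (fin_res w m) (perp_ 1 (fin_res w m))
    & a \/ b \/ c ->
      [/\ hereditary_Hovey_triple Q W R,
          Q `&` W `&` R = fin_res P m `&` R
        & exists cong : is_congruence (stably_equal (Q `&` R) (Q `&` W `&` R)),
            (exists Ho : category, is_homotopy_category Q W R Ho) /\
            forall Ho : category, is_homotopy_category Q W R Ho ->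
              equivalent_categories Ho (quotient_category cong)]].
Proof.
move=> w P Q W R a b c.
have ac : a -> c := epikernels_core_projective enoughP ctpX herX ctpw.
have bc : b -> c := fin_res_epikernels_core_projective enoughP ctpX herX ctpw.
have ca : c -> a := core_projective_epikernels enoughP ctpX.
have cb : c -> b := core_projective_fin_res_epikernels enoughP.
split.
- by split; split; [move/ac/cb|move/bc/ca| |].
- exact: perp_thick enoughP ctpX herX.
- exact: fin_res_hereditary enoughP ctpX herX ctpw.
move=> abc; have wP : c by case: abc => [/ac|[/bc|]].
have hov := dim_hereditary_Hovey_triple enoughP ctpX herX ctpw wP.
split; first exact: hov.
  by rewrite (cap_perp_fin_res_projective m enoughP ctpX herX wP).
exact: Hovey_homotopy_category.
Qed.
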